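(* Let $C \subset \mathbb{C}\mathbb{P}^2$ be a non-singular real algebraic plane projective curve of degree $d$ and of type I, and let $l$ be the number of connected components of $\mathbb{R}C$. Assume one of the following: \begin{enumerate} \item $d = 2s+1$ for some $s \in \mathbb{Z}_{\geq 2}$, and $$1-\varepsilon + \frac{s^2-5s+4}{2} < \left\lfloor \frac{l}{2}\right\rfloor < \frac{s^2+s-2}{2},$$ where $\varepsilon \in \{0,1\}$ is such that $l \equiv \varepsilon \mod 2$. \item $d = 2s$ for some $s \in \mathbb{Z}_{\geq 3}$, and $$\max\left(0,\ 1-\varepsilon + \frac{s^2-7s+10}{2}\right) < \left\lfloor \frac{l-1}{2}\right\rfloor < \frac{s^2-s-2}{2},$$ where $\varepsilon \in \{0,1\}$ is such that $l-1 \equiv \varepsilon \mod 2$. \end{enumerate} Then $C$ admits no totally real pencil of curves of degree $k$ such that $kd \leq l$.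
   Context: $\mathbb{C}\mathbb{P}^2$ carries the standard complex conjugation. A real plane projective curve of degree $d$ is the zero set in $\mathbb{C}\mathbb{P}^2$ of a homogeneous polynomial of degree $d$ with real coefficients; $\mathbb{R}C$ is the set of real points of $C$ (points fixed by conjugation). A non-singular real algebraic curve $C$ is of type I (or separating) if $C \setminus \mathbb{R}C$ is disconnected. Let $\mathbb{R}[x,y,z]_k$ be the space of real homogeneous polynomials of degree $k$, and let $V(\cdot)$ denote the zero set in $\mathbb{C}\mathbb{P}^2$. A non-singular real plane projective curve $C$ of type I admits a totally real pencil of curves of degree $k$ ($k$ an integer) if there are $f,g \in \mathbb{R}[x,y,z]_k$ such that $V(f,g)\cap C = \emptyset$ and $V(\lambda f + \mu g)\cap C$ consists of real points only for all $\lambda,\mu \in \mathbb{R}$ not both zero. *)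

(* Defs.v *)
From HB Require Import structures.
(* The notations of mpoly clash with those of all_analysis. *)
From mathcomp Require Import -(notations) mpoly.
From mathcomp Require Import all_boot all_order all_algebra generic_quotient.
From mathcomp Require Import complex.
From mathcomp Require Import all_classical all_reals all_analysis.

Set Implicit Arguments.
Unset Strict Implicit.
Unset Printing Implicit Defensive.

Import Order.TTheory GRing.Theory Num.Theory.
Import numFieldNormedType.Exports.

Local Open Scope classical_set_scope.
Local Open Scope ring_scope.
Local Open Scope quotient_scope.
Local Open Scope complex_scope.

(* all_analysis puts no topology on [R[i]] itself, only on [R[i]^o], where it
   is the one given by the modulus. *)
HB.instance Definition _ (R : realType) :=
  PseudoPointedMetric.copy R[i] R[i]^o.

Section ProjectivePlane.
Variable R : realType.

(* C^3 \ {0}, with the subspace topology of [set_type]. *)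
Definition nzvec : set 'rV[R[i]]_3 := [set v | v != 0].

Definition proportional (v w : nzvec) : bool :=
  `[< exists2 a : R[i], a != 0 & val w = a *: val v >].

Lemma proportional_refl : reflexive proportional.
Proof. by move=> v; apply/asboolP; exists 1; rewrite ?oner_neq0 ?scale1r. Qed.

Lemma proportional_sym : symmetric proportional.
Proof.
have imp v w : proportional v w -> proportional w v.
  move=> /asboolP[a a0 e]; apply/asboolP; exists a^-1; first by rewrite invr_eq0.
  by rewrite e scalerA mulVf ?scale1r.
by move=> v w; apply/idP/idP; apply: imp.
Qed.

Lemma proportional_trans : transitive proportional.
Proof.
move=> w v u /asboolP[a a0 ea] /asboolP[b b0 eb]; apply/asboolP.
by exists (b * a); rewrite ?mulf_neq0 // eb ea scalerA.
Qed.

Canonical proportional_equiv :=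
  EquivRel proportional proportional_refl proportional_sym proportional_trans.

Definition CP2 := quotient_topology {eq_quot proportional}.

HB.instance Definition _ := Topological.on CP2.

Definition proj (v : nzvec) : CP2 := \pi_({eq_quot proportional}) v.

Lemma conj_subproof (v : nzvec) : nzvec (map_mx conjc (val v)).
Proof.
rewrite /nzvec /= map_mx_eq0; exact: set_valP v.
Qed.

Definition conj_nzvec (v : nzvec) : nzvec := SigSub (mem_set (conj_subproof v)).

Definition conjCP2 (p : CP2) : CP2 := proj (conj_nzvec (repr p)).

Lemma conjCP2_proj (v : nzvec) : conjCP2 (proj v) = proj (conj_nzvec v).
Proof.
rewrite /conjCP2; set w := repr _.
have /eqmodP/asboolP[a a0 e] : proj v = proj w by rewrite /proj /w reprK.
apply/esym/eqmodP/asboolP; exists (conjc a); first by rewrite conjc_eq0.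
by rewrite /= e map_mxZ.
Qed.

Definition real_points (C : set CP2) : set CP2 :=
  [set p | C p /\ conjCP2 p = p].

Definition evalC (f : mpoly 3 R) (v : 'rV[R[i]]_3) : R[i] :=
  meval (fun j => v 0 j) (map_mpoly (real_complex R) f).

(* R[x,y,z]_k, which is {0} for negative k. *)
Definition real_form (k : int) (f : mpoly 3 R) : Prop :=
  match k with
  | Posz n => f \is ishomog1 n mdeg
  | Negz _ => f = 0
  end.

Definition V (f : mpoly 3 R) : set CP2 :=
  [set proj v | v in [set v : nzvec | evalC f (val v) = 0]].

Lemma evalCE (f : mpoly 3 R) v :
  evalC f v =
  \sum_(m <- msupp f) (mcoeff m f)%:C *
     \prod_(j < 3) v 0 j ^+ fun_of_multinom m j.
Proof.
rewrite /evalC mevalE (perm_big _ (msupp_map_mpoly _ _)) /=; last exact: fmorph_inj.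
by apply: eq_bigr => m _; rewrite mcoeff_map_mpoly.
Qed.

Lemma V_proj (k : int) (f : mpoly 3 R) (v : nzvec) :
  real_form k f -> V f (proj v) <-> evalC f (val v) = 0.
Proof.
move=> hf; split; last by exists v.
case=> w /= fw /eqmodP/asboolP[a a0 e].
case: k hf => n /= hf; last by rewrite hf /evalC raddf0 meval0.
suff -> : evalC f (val v) = a ^+ n * evalC f (val w) by rewrite fw mulr0.
rewrite !evalCE mulr_sumr; apply: eq_big_seq => m mf.
have <- : mdeg m = n by exact: (dhomogP _ _ _ hf).
rewrite mulrCA; congr (_ * _); rewrite mdegE -prodrXr -big_split /=.
by apply: eq_bigr => j _; rewrite e mxE exprMn.
Qed.

Definition nonsingular (P : mpoly 3 R) : Prop :=
  forall v : nzvec, evalC P (val v) = 0 ->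
    exists i : 'I_3, evalC (mderiv i P) (val v) != 0.

Definition nonsingular_real_curve (d : nat) (C : set CP2) : Prop :=
  exists P : mpoly 3 R, [/\ real_form d P, nonsingular P & C = V P].

Definition type_I (C : set CP2) : Prop := ~ connected (C `\` real_points C).

Definition nb_components (A : set CP2) (l : nat) : Prop :=
  ([set connected_component A p | p in A] #= `I_l)%card.

Definition totally_real_pencil (C : set CP2) (k : int) : Prop :=
  exists f g : mpoly 3 R,
    [/\ real_form k f, real_form k g, V f `&` V g `&` C = set0 &
        forall lambda mu : R, (lambda, mu) != (0, 0) ->
          V (lambda *: f + mu *: g) `&` C `<=` real_points C].

End ProjectivePlane.

Arguments nzvec : clear implicits.

(* Main.v *)
Require Import Defs.
From mathcomp Require Import -(notations) mpoly.
From mathcomp Require Import all_boot all_order all_algebra perm.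
From mathcomp Require Import complex zify ring lra.
From mathcomp Require Import all_classical all_reals all_analysis.

(** Let [C] be a smooth curve of type I and degree [d > 1] with a totally real
    pencil spanned by [f] and [g] of degree [k], and suppose [k d <= l].  When
    [k <= 0] the forms [f] and [g] are constants, so [C] lies in the base locus
    or inside one member of the pencil; both are impossible since [C] has
    non-real points ([pencil_degree_gt0]).  So let [k > 0].

    Every component [K] of the real locus meets every real member of the
    pencil.  Indeed the parameters of the members with a zero on [K] form a
    closed set, as [K] is compact, and this set is open: when the member
    varies, its intersection points with [C] vary continuously, they stay real
    because the pencil is totally real, and they stay on [K] because the other
    components, being finitely many, form a closed set
    ([zero_persists], [piece_meets_member]).

    By Bezout a member meets [C] in at most [k d <= l] points ([bezout]), hence
    it meets each of the [l] components exactly once ([zero_of_member_unique]).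
    A component [K] is therefore in bijection with the real projective line of
    parameters, and this makes it one-sided: every real line [u = 0] meets [K].
    Otherwise [(f / u^k, g / u^k)] would map [K] continuously to the punctured
    plane so that every line through the origin is hit exactly once; turning
    such a line by a half turn would move the unique point on it from one half
    line to the opposite one without leaving its side ([piece_meets_line]).

    Finally take the real line through two points of one component.  It meets
    all the components, so it contains [l + 1 > d] points of [C] and is part of
    [C] ([line_in_curve]); but a smooth curve of degree [d > 1] contains no
    line ([smooth_no_line]).

    Bezout and the persistence of zeros both come from one elimination
    polynomial.  Project [C] from a real point off [C] and let [x] be the
    coordinate on the target: the abscissas of the common zeros of [F] and of a
    form [h] of degree [k] are the roots of a polynomial of degree at most
    [k d] ([chart_elim]).  For a member [h] of a totally real pencil this
    polynomial has only real roots.  It is non-zero, since the imaginary unit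
    is not a root, which gives Bezout; and a real-rooted polynomial that is
    small at a point has a root nearby ([real_rooted_bound]), which gives the
    persistence. *)

Set Implicit Arguments.
Unset Strict Implicit.
Unset Printing Implicit Defensive.

Import Order.TTheory GRing.Theory Num.Theory.
Import numFieldNormedType.Exports.
Local Open Scope classical_set_scope.
Local Open Scope ring_scope.
Local Open Scope complex_scope.

(** * Evaluating forms on vectors and along lines *)

(** [phi] is kept general because the same form is evaluated on real vectors,
    on complex vectors and on vectors of polynomials. *)
Definition ev n (R S : comNzRingType) (phi : R -> S) (v : 'rV[S]_n)
  (F : mpoly n R) : S := mmap phi (fun j => v 0 j) F.

Section Evaluation.
Variables (n : nat) (R S : comNzRingType) (phi : {rmorphism R -> S}).
Implicit Types (v w : 'rV[S]_n) (F G : mpoly n R).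

Lemma evE v F : ev phi v F =
  \sum_(m <- msupp F) phi (mcoeff m F) * \prod_j v 0 j ^+ fun_of_multinom m j.
Proof. by []. Qed.

Lemma evD v F G : ev phi v (F + G) = ev phi v F + ev phi v G.
Proof. exact: mmapD. Qed.

Lemma evZ v a F : ev phi v (a *: F) = phi a * ev phi v F.
Proof. exact: mmapZ. Qed.

Lemma evC v a : ev phi v (mpolyC n a) = phi a.
Proof. exact: mmapC. Qed.

Lemma evXU v i : ev phi v (mpolyX R (mnm1 i)) = v 0 i.
Proof. by rewrite /ev mmapX mmap1U. Qed.

Lemma ev_rmorph (T : comNzRingType) (psi : {rmorphism S -> T}) v F :
  psi (ev phi v F) = ev (psi \o phi) (map_mx psi v) F.
Proof.
rewrite !evE rmorph_sum; apply: eq_bigr => m _.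
rewrite rmorphM rmorph_prod; congr (_ * _).
by apply: eq_bigr => j _; rewrite rmorphXn mxE.
Qed.

Lemma eq_ev (phi' : R -> S) v F : phi =1 phi' -> ev phi v F = ev phi' v F.
Proof. by move=> e; rewrite /ev /mmap; apply: eq_bigr => m _; rewrite e. Qed.

Lemma ev_scale d (c : S) v F : F \is ishomog1 d mdeg ->
  ev phi (c *: v) F = c ^+ d * ev phi v F.
Proof.
move=> hF; rewrite !evE mulr_sumr; apply: eq_big_seq => m mF.
have <- : mdeg m = d by exact: (dhomogP _ _ _ hF).
rewrite mulrCA; congr (_ * _); rewrite mdegE -prodrXr -big_split /=.
by apply: eq_bigr => j _; rewrite mxE exprMn.
Qed.

End Evaluation.

(** The restriction of [F] to the line through [v] with direction [w]. *)
Definition along n (R S : comNzRingType) (phi : R -> S) (v w : 'rV[S]_n)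
  (F : mpoly n R) : {poly S} :=
  ev (polyC \o phi) (map_mx polyC v + 'X *: map_mx polyC w) F.

Section Along.
Variables (n : nat) (R S : comNzRingType) (phi : {rmorphism R -> S}).
Implicit Types (v w : 'rV[S]_n) (F G : mpoly n R).

Lemma along_horner v w F s : (along phi v w F).[s] = ev phi (v + s *: w) F.
Proof.
rewrite -[LHS]/(horner_eval s _) /along ev_rmorph.
rewrite (eq_ev (phi' := phi)) => [|a /=]; last by rewrite /horner_eval hornerC.
by congr ev; apply/rowP => j; rewrite !mxE /= /horner_eval ?hornerE.
Qed.

(** The top coefficient is the value of [F] at the point at infinity [w] of the
    line; degree and top coefficient are tracked together through products. *)
Lemma size_along d v w F : F \is ishomog1 d mdeg ->
  (size (along phi v w F) <= d.+1)%N /\ (along phi v w F)`_d = ev phi w F.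
Proof.
pose P e (c : S) (p : {poly S}) := (size p <= e.+1)%N /\ p`_e = c.
have P0 c : P 0 c c%:P by split; [exact: size_polyC_leq1 | rewrite coefC].
have PM a b x y p q : P a x p -> P b y q -> P (a + b)%N (x * y) (p * q).
  move=> [sp px] [sq qy]; split.
    rewrite (leq_trans (size_polyMleq _ _))// -subn1 leq_subLR.
    by rewrite (leq_trans (leq_add sp sq))// addnS.
  rewrite coefM (bigD1 (Ordinal (leq_addr b a.+1 : (a < (a + b).+1)%N)))//=.
  rewrite addKn px qy big1 ?addr0// => i /eqP ni.
  have [ia|lt] := ltnP i a.
    rewrite [q`__]nth_default ?mulr0// (leq_trans sq)//.
    by rewrite ltn_subRL ltn_add2r.
  rewrite nth_default ?mul0r// (leq_trans sp)// ltn_neqAle lt andbT.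
  by apply/negP => /eqP e; apply: ni; apply: val_inj.
have PX a x p b : P a x p -> P (a * b)%N (x ^+ b) (p ^+ b).
  move=> Pp; elim: b => [|b IH]; first by rewrite muln0 !expr0; exact: P0.
  by rewrite mulnS !exprS; exact: PM.
move=> hF; rewrite /along /ev /mmap -/(P d _ _).
have Pm m : m \in msupp F -> P d (phi (mcoeff m F) * mmap1 (fun j => w 0 j) m)
    ((polyC \o phi) (mcoeff m F) *
     mmap1 (fun j => (map_mx polyC v + 'X *: map_mx polyC w) 0 j) m).
  move=> mF; have <- : mdeg m = d by exact: (dhomogP _ _ _ hF).
  rewrite -[mdeg m]add0n; apply: (PM); first exact: P0.
  rewrite mdegE /mmap1; elim/big_rec3: _ => [|j e x p _ IH]; first exact: P0.
  apply: (PM) IH; rewrite -[X in P X]mul1n; apply: PX.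
  rewrite !mxE addrC mulrC; split.
    by rewrite size_MXaddC; case: ifP => // _; rewrite ltnS size_polyC_leq1.
  by rewrite coefD coefMX coefC /= coefC addr0.
elim: (msupp F) Pm => [|m s IH] Pm.
  by rewrite !big_nil; split; rewrite ?size_poly0 ?coef0.
rewrite !big_cons; have [|s1 e1] := Pm m; first exact: mem_head.
have [|s2 e2] := IH; first by move=> x xs; apply: Pm; rewrite in_cons xs orbT.
split; last by rewrite coefD e1 e2.
by rewrite (leq_trans (size_polyD _ _))// geq_max s1 s2.
Qed.

(** The chain rule.  The forms satisfying it are stable under sums and products
    and include constants and variables, hence are all polynomials. *)
Lemma deriv_along v w F :
  (along phi v w F)^`() = \sum_j (w 0 j)%:P * along phi v w (mderiv j F).
Proof.
pose D p := (along phi v w p)^`() = \sum_j (w 0 j)%:P * along phi v w (mderiv j p).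
have alM p q : along phi v w (p * q) = along phi v w p * along phi v w q.
  by rewrite /along /ev rmorphM.
have DC c : D (mpolyC n c).
  rewrite /D /along evC derivC big1// => j _; rewrite mderivC.
  by rewrite -[ev _ _ _]/(mmap _ _ 0) mmap0 mulr0.
have DM p q : D p -> D q -> D (p * q).
  rewrite /D => Dp Dq; rewrite alM derivM Dp Dq mulr_suml mulr_sumr -big_split.
  apply: eq_bigr => j _ /=.
  rewrite mderivM [in RHS]/along evD -!/(along _ _ _ _) !alM.
  by rewrite mulrDr; congr (_ + _); [rewrite mulrA | rewrite mulrCA].
have DX i : D (mpolyX R (mnm1 i)).
  rewrite /D /along evXU !mxE derivD derivC add0r derivM derivX derivC mulr0.
  rewrite addr0 mul1r (bigD1 i)//= big1 ?addr0 => [|j ji].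
    rewrite mderivX mnm1E eqxx scale1r (_ : mnm_sub _ _ = mnm0).
      by rewrite /ev mmapX mmap11 mulr1.
    by apply/mnmP => k; rewrite mnmBE mnm0E subnn.
  by rewrite mderivX mnm1E eq_sym (negbTE ji) scale0r /ev mmap0 mulr0.
elim/mpolyind: F => [|c m p _ _ IH].
  rewrite /along /ev mmap0 deriv0 big1// => j _.
  by rewrite mderiv0 mmap0 mulr0.
rewrite -/(D _).
have Dm : D (mpolyX R m).
  rewrite mpolyXE_id; apply: big_ind => [|//|j _]; first exact: DC.
  elim: (fun_of_multinom m j) => [|a IHa]; first by rewrite expr0; exact: DC.
  by rewrite exprS; exact: DM.
have := DM _ _ (DC c) Dm; rewrite mul_mpolyC.
rewrite /D /along evD derivD => ->; rewrite -!/(along _ _ _ _) IH -big_split.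
apply: eq_bigr => j _ /=.
by rewrite mderivD /along evD mulrDr.
Qed.

Lemma dhomog_mderiv d j F : F \is ishomog1 d.+1 mdeg ->
  mderiv j F \is ishomog1 d mdeg.
Proof.
move=> hF; apply/dhomogP => m; rewrite mcoeff_msupp mcoeff_mderiv => nz.
have mF : mnm_add m (mnm1 j) \in msupp F.
  by rewrite mcoeff_msupp; apply: contraNneq nz => ->; rewrite mul0rn.
by have := dhomogP _ _ _ hF _ mF; rewrite /= mdegD mdeg1 addn1 => -[].
Qed.

Lemma deriv_along0 v w F :
  (along phi v w F)^`().[0] = \sum_j w 0 j * ev phi v (mderiv j F).
Proof.
rewrite deriv_along horner_sum; apply: eq_bigr => j _.
by rewrite hornerM hornerC along_horner scale0r addr0.
Qed.

End Along.

(** * Elimination by a companion matrix *)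

Section Elimination.
Variables (K : fieldType) (n : nat).
Implicit Types (F G : {poly {poly K}}) (A B : 'M[{poly K}]_n.+1) (k l : nat).

(** A polynomial in two variables, written over the polynomials in the first
    one.  The subtraction is truncated, so coefficients of index above [k]
    vanish. *)
Definition total_degree_le k G := forall j, (size (G`_j)%R <= k.+1 - j)%N.

Lemma size_mul_truncated (p q : {poly K}) a b c e :
  (size p <= a.+1 - c)%N -> (size q <= (b + c).+1 - e)%N ->
  (size (p * q)%R <= (a + b).+1 - e)%N.
Proof.
have [->|p0] := eqVneq p 0; first by rewrite mul0r size_poly0.
have [->|q0] := eqVneq q 0; first by rewrite mulr0 size_poly0.
move=> sp sq; rewrite (leq_trans (size_polyMleq _ _))//.
move: p0 q0 sp sq; rewrite -!size_poly_gt0; lia.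
Qed.

(** Give index [i] the weight [i]: entry [(i, j)] has degree at most [k + i - j].
    Products add [k], and in a determinant the weights of rows and columns
    cancel, which yields the degree bound of Bezout's theorem. *)
Definition graded k A :=
  forall i j : 'I_n.+1, (size (A i j) <= (k + i).+1 - j)%N.

Lemma graded_sum k (I : Type) (r : seq I) (E : I -> 'M[{poly K}]_n.+1) :
  (forall i, graded k (E i)) -> graded k (\sum_(i <- r) E i).
Proof.
move=> hE; apply: big_ind => [i j|A B hA hB i j|i _]; last exact: hE.
  by rewrite mxE size_poly0.
by rewrite mxE (leq_trans (size_polyD _ _))// geq_max hA hB.
Qed.

Lemma gradedM k l A B : graded k A -> graded l B -> graded (k + l) (A * B).
Proof.
move=> hA hB i j; rewrite -[A * B]/(A *m B) mxE (leq_trans (size_sum _ _ _))//.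
apply/bigmax_leqP => h _.
by rewrite addnAC; apply: size_mul_truncated (hA i h) (hB h j).
Qed.

Lemma gradedX A m : graded 1 A -> graded m (A ^+ m).
Proof.
move=> hA; elim: m => [|m IH]; last by rewrite exprS -add1n; exact: gradedM.
move=> i j; rewrite expr0 mxE; case: eqVneq => [->|_]; last by rewrite size_poly0.
by rewrite size_poly1; lia.
Qed.

Lemma graded_horner k A G : graded 1 A -> total_degree_le k G ->
  graded k (horner_mx A G).
Proof.
move=> hA hG; rewrite -[G]coefK poly_def linear_sum; apply: graded_sum => m.
rewrite linearZ rmorphXn /= horner_mx_X => i j; rewrite mxE.
apply: size_mul_truncated (hG m) _; rewrite addnC.
exact: gradedX.
Qed.

Lemma size_det_graded k A : graded k A -> (size (\det A) <= (k * n.+1).+1)%N.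
Proof.
move=> hA; rewrite (leq_trans (size_sum _ _ _))//; apply/bigmax_leqP => s _.
rewrite size_Msign.
have [/existsP[i /eqP Ai]|] := boolP [exists i, A i (s i) == 0].
  by rewrite (bigD1 i)//= Ai mul0r size_poly0.
rewrite negb_exists => /forallP nz.
rewrite (leq_trans (size_poly_prod_leq _ _))// card_ord leq_subLR.
have : (\sum_(i < n.+1) (size (A i (s i)) + s i) <=
        \sum_(i < n.+1) (k.+1 + i))%N.
  apply: leq_sum => i _; move: (hA i (s i)) (nz i); rewrite -size_poly_gt0; lia.
(* The weights of the columns are a permutation of those of the rows. *)
have sE : (\sum_(i < n.+1) i = \sum_(i < n.+1) s i)%N.
  by rewrite (reindex_inj (@perm_inj _ s)).
rewrite !big_split /= sum_nat_const card_ord sE leq_add2r => H.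
by rewrite addnS ltnS (leq_trans H)// mulnS mulnC.
Qed.

(** Same entries as [companionmx F], at a size of the form [n.+1], for which square
    matrices form a non-trivial ring. *)
Definition companion F : 'M[{poly K}]_n.+1 := \matrix_(i, j)
  if i == n :> nat then - F`_j else (i.+1 == j :> nat)%:R.

Lemma char_poly_companion F : F \is monic -> size F = n.+2 ->
  char_poly (companion F) = F.
Proof.
move=> mF sF; rewrite -[RHS](companionmxK mF) /companionmx sF /=.
by congr char_poly; apply/matrixP => i j; rewrite !mxE.
Qed.

Lemma graded_companion F : total_degree_le n.+1 F -> graded 1 (companion F).
Proof.
move=> hF i j; rewrite mxE; case: eqP => [->|_].
  by rewrite size_polyN add1n; exact: hF.
by case: eqP => [<-|_]; rewrite ?size_poly0 ?size_poly1//; lia.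
Qed.

Definition elim_poly F G : {poly K} := \det (horner_mx (companion F) G).

Lemma size_elim_poly k F G : total_degree_le n.+1 F -> total_degree_le k G ->
  (size (elim_poly F G) <= (k * n.+1).+1)%N.
Proof.
by move=> hF hG; apply/size_det_graded/graded_horner => //; exact: graded_companion.
Qed.

(** In a pencil the matrix [horner_mx (companion F) _] is affine in the
    parameter. *)
Lemma elim_poly_pencil F G H x :
  exists p : {poly K}, forall t, (elim_poly F (G + t%:P *: H)).[x] = p.[t].
Proof.
pose M := companion F.
pose X := map_mx (horner_eval x) (horner_mx M G).
pose Y := map_mx (horner_eval x) (horner_mx M H).
exists (\det (map_mx polyC X + 'X *: map_mx polyC Y)) => t.
rewrite -/(horner_eval x _) -/(horner_eval t _) /elim_poly -!det_map_mx.
congr (\det _); rewrite linearD linearZ /= -/M.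
by apply/matrixP => i j; rewrite !mxE /horner_eval !hornerE.
Qed.

(** Over an algebraically closed field [G] splits into factors ['X - w], and
    the determinant of [M - w] is up to sign the value at [w] of the
    characteristic polynomial of [M], which is [F]. *)
Lemma root_elim_poly (L : closedFieldType) (iota : {rmorphism K -> L}) F G z :
  F \is monic -> size F = n.+2 ->
  root (map_poly iota (elim_poly F G)) z <->
  exists y, root (map_poly (horner_eval z \o map_poly iota) F) y /\
            root (map_poly (horner_eval z \o map_poly iota) G) y.
Proof.
move=> mF sF; set phi := horner_eval z \o _.
have cF := char_poly_companion mF sF.
pose M := map_mx phi (companion F).
have cM : char_poly M = map_poly phi F by rewrite /M -map_char_poly cF.
have -> : root (map_poly iota (elim_poly F G)) z =
    (\det (horner_mx M (map_poly phi G)) == 0).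
  rewrite /root -[_.[z]]/(phi _) /elim_poly.
  by rewrite -[phi _]det_map_mx map_horner_mx.
have [r ->] := closed_field_poly_normal (map_poly phi G).
set c := lead_coef _.
have detE w : (\det (horner_mx M ('X - w%:P)) == 0) = root (map_poly phi F) w.
  rewrite rmorphB /= horner_mx_X horner_mx_C -cM -eigenvalue_root_char.
  by rewrite /eigenvalue kermx_eq0 row_free_unit unitmxE unitfE negbK.
have -> : \det (horner_mx M (c *: \prod_(w <- r) ('X - w%:P))) =
    c ^+ n.+1 * \prod_(w <- r) \det (horner_mx M ('X - w%:P)).
  rewrite linearZ /= detZ rmorph_prod; congr (_ * _).
  by apply: (big_morph _ (@det_mulmx _ _)); exact: det1.
rewrite mulf_eq0 expf_eq0 /=; split.
  case/orP => [/eqP ->|].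
    have /closed_rootP[y Fy] : size (map_poly phi F) != 1%N.
      by rewrite -cM size_char_poly.
    by exists y; rewrite scale0r root0.
  rewrite prodf_seq_eq0 => /hasP[w wr /=]; rewrite detE => Fw.
  exists w; split=> //; rewrite /root hornerZ mulf_eq0 -/(root _ _).
  by rewrite root_prod_XsubC wr orbT.
case=> y [Fy]; have [->|c0] := eqVneq c 0; first by [].
rewrite rootZ// root_prod_XsubC => yr; apply/orP; right.
by rewrite prodf_seq_eq0; apply/hasP; exists y; rewrite //= detE.
Qed.

End Elimination.

(** * Projecting the curve from a real point *)

Lemma total_degree_leM (K : fieldType) a b (p q : {poly {poly K}}) :
  total_degree_le a p -> total_degree_le b q -> total_degree_le (a + b) (p * q).
Proof.
move=> hp hq j; rewrite coefM (leq_trans (size_sum _ _ _))//.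
apply/bigmax_leqP => i _; apply: size_mul_truncated (hp i) _.
by move: (hq (j - i)%N) (ltn_ord i); lia.
Qed.

Lemma total_degree_ev n (R K : fieldType) (phi : {rmorphism R -> K})
    (X : 'rV[{poly {poly K}}]_n) d (F : mpoly n R) :
  (forall j, total_degree_le 1 (X 0 j)) -> F \is ishomog1 d mdeg ->
  total_degree_le d (ev (polyC \o (polyC \o phi)) X F).
Proof.
move=> hX hF; rewrite evE big_seq; apply: big_ind => [j|p q hp hq j|m mF].
- by rewrite coef0 size_poly0.
- by rewrite coefD (leq_trans (size_polyD _ _))// geq_max hp hq.
have <- : mdeg m = d by exact: (dhomogP _ _ _ hF).
have h0 (c : K) : total_degree_le 0 c%:P%:P.
  by case=> [|j]; rewrite coefC //= ?size_polyC_leq1 ?size_poly0.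
rewrite -[mdeg m]add0n; apply: total_degree_leM; first exact: h0.
rewrite mdegE; elim/big_rec2: _ => [|i p a _ IH]; first exact: h0.
apply: total_degree_leM IH.
elim: (fun_of_multinom m i) => [|a' IH]; first by rewrite expr0; exact: h0.
by rewrite exprS -add1n; exact: total_degree_leM.
Qed.

Section Chart.
Variables (R : rcfType) (Q N : 'M[R]_3).
Hypothesis QN : Q *m N = 1%:M.
Let iota : {rmorphism R -> R[i]} := real_complex R.
Implicit Types (F h : mpoly 3 R).

Definition complexify (w : 'rV[R]_3) : 'rV[R[i]]_3 := map_mx (real_complex R) w.

(** [F] in the affine chart of the basis of rows of [Q]: row 0 is the centre of
    projection, along which the outer variable runs, row 2 is the direction of
    the abscissa, and row 1 is the origin. *)
Definition chart_poly F : {poly {poly R}} :=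
  along (polyC : R -> {poly R})
    (map_mx polyC (row 1 Q) + 'X *: map_mx polyC (row 2 Q))
    (map_mx polyC (row 0 Q)) F.

Definition chart (x y : R[i]) : 'rV[R[i]]_3 :=
  complexify (row 1 Q) + x *: complexify (row 2 Q) + y *: complexify (row 0 Q).

Lemma chart_poly_horner F x y :
  (map_poly (horner_eval x \o map_poly iota) (chart_poly F)).[y] =
  ev iota (chart x y) F.
Proof.
pose psi : {rmorphism {poly R} -> R[i]} := horner_eval x \o map_poly iota.
rewrite -[LHS]/((horner_eval y \o map_poly psi) _) /chart_poly /along.
rewrite ev_rmorph (eq_ev (phi' := iota)) => [|a].
  congr ev; apply/rowP => j; rewrite !mxE.
  rewrite -[LHS]/((map_poly psi _).[y]) rmorphD rmorphM /= map_polyX !map_polyC.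
  rewrite hornerD hornerM hornerX !hornerC /psi /= /horner_eval.
  rewrite !rmorphD !rmorphM /= map_polyX !map_polyC /=.
  by rewrite hornerD hornerM hornerX !hornerC.
by rewrite /= map_polyC /= map_polyC /horner_eval !hornerE.
Qed.

Lemma total_degree_chart d F : F \is ishomog1 d mdeg ->
  total_degree_le d (chart_poly F).
Proof.
apply: (@total_degree_ev 3 R R idfun) => i [|[|j]];
  rewrite !mxE !(coefD, coefC, coefMC, coefX, coefXM) /= ?addr0.
- rewrite mul0r addr0 addrC mulrC size_MXaddC subn0.
  by case: ifP => // _; rewrite ltnS size_polyC_leq1.
- by rewrite add0r mul1r size_polyC_leq1.
- by rewrite add0r mul0r size_poly0.
Qed.

Variables (d : nat) (F : mpoly 3 R).
Hypothesis hF : F \is ishomog1 d.+1 mdeg.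
Let e := ev idfun (row 0 Q) F.
Hypothesis e0 : e != 0.

Let monic_chart_poly : {poly {poly R}} := e^-1%:P *: chart_poly F.

Lemma chart_poly_lead : (size (chart_poly F) <= d.+2)%N /\
  (chart_poly F)`_d.+1 = e%:P.
Proof.
have [sF ->] := size_along (polyC : {rmorphism R -> {poly R}})
  (map_mx polyC (row 1 Q) + 'X *: map_mx polyC (row 2 Q))
  (map_mx polyC (row 0 Q)) hF.
by split=> //; rewrite /e [RHS](ev_rmorph idfun (polyC : {rmorphism R -> {poly R}})).
Qed.

Lemma monic_chart_polyP : monic_chart_poly \is monic /\ size monic_chart_poly = d.+2.
Proof.
have [sF cF] := chart_poly_lead.
have c1 : monic_chart_poly`_d.+1 = 1 by rewrite coefZ cF -polyCM mulVf.
have s1 : size monic_chart_poly = d.+2.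
  apply/eqP; rewrite eqn_leq (leq_trans (size_scale_leq _ _))//=.
  by rewrite ltnNge; apply/negP => /leq_sizeP/(_ _ (leqnn _))/eqP; rewrite c1 oner_eq0.
by split=> //; rewrite monicE lead_coefE s1 c1.
Qed.

(** The polynomial whose roots are the abscissas of the common zeros of [F] and
    [h] in the chart. *)
Definition chart_elim h : {poly R} := elim_poly d monic_chart_poly (chart_poly h).

Lemma size_chart_elim k h : h \is ishomog1 k mdeg ->
  (size (chart_elim h) <= (k * d.+1).+1)%N.
Proof.
move=> hh; apply: size_elim_poly (total_degree_chart hh) => j.
rewrite coefZ; have [->|F0] := eqVneq (chart_poly F)`_j 0.
  by rewrite mulr0 size_poly0.
rewrite mul_polyC (leq_trans (size_scale_leq _ _))//.
exact: total_degree_chart.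
Qed.

Lemma chart_elim_pencil G H x :
  exists p : {poly R}, forall t, (chart_elim (G + t *: H)).[x] = p.[t].
Proof.
have [p hp] := elim_poly_pencil d monic_chart_poly (chart_poly G) (chart_poly H) x.
exists p => t; rewrite -hp; congr (elim_poly _ _ _).[_].
by rewrite /chart_poly /along evD evZ mul_polyC.
Qed.

Lemma root_chart_elim h z : root (map_poly iota (chart_elim h)) z <->
  exists y, ev iota (chart z y) F = 0 /\ ev iota (chart z y) h = 0.
Proof.
have [mF sF] := monic_chart_polyP.
rewrite (root_elim_poly iota _ _ mF sF).
have E y : root (map_poly (horner_eval z \o map_poly iota) monic_chart_poly) y =
    (ev iota (chart z y) F == 0).
  rewrite /monic_chart_poly map_polyZ /= map_polyC /= /horner_eval hornerC.
  rewrite rootZ; first by rewrite /root chart_poly_horner.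
  by rewrite fmorph_eq0 invr_eq0.
by split=> -[y [h1 h2]]; exists y; move: h1 h2; rewrite E /root chart_poly_horner;
  [move=> /eqP -> /eqP -> | move=> -> ->; rewrite eqxx].
Qed.

Lemma complexify_mul (w : 'rV[R]_3) (M : 'M[R]_3) :
  complexify (w *m M) = complexify w *m map_mx (real_complex R) M.
Proof. exact: map_mxM. Qed.

Lemma chart_coords x y : chart x y *m map_mx (real_complex R) N =
  y *: delta_mx 0 0 + delta_mx 0 1 + x *: delta_mx 0 2.
Proof.
have rowE j : complexify (row j Q) *m map_mx (real_complex R) N = delta_mx 0 j.
  rewrite -complexify_mul -row_mul QN row1; apply/rowP => i.
  by rewrite !mxE rmorph_nat.
by rewrite /chart !mulmxDl -!scalemxAl !rowE [RHS]addrC addrA addrC [RHS]addrA addrAC.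
Qed.

Lemma chart_coord1 x y : (chart x y *m map_mx (real_complex R) N) 0 1 = 1.
Proof. by rewrite chart_coords !mxE /= !mulr0 add0r addr0. Qed.

Lemma chart_coord2 x y : (chart x y *m map_mx (real_complex R) N) 0 2 = x.
Proof. by rewrite chart_coords !mxE /= !mulr0 mulr1 !add0r. Qed.

Lemma chart_of_coords (w : 'rV[R[i]]_3) :
  let c := w *m map_mx (real_complex R) N in
  c 0 1 = 1 -> w = chart (c 0 2) (c 0 0).
Proof.
move=> c c1; have Nu : map_mx (real_complex R) N \in unitmx.
  by rewrite map_unitmx; case/mulmx1_unit: QN.
apply: (can_inj (mulmxK Nu)).
rewrite chart_coords -/c; move: c c1 => c c1; apply/rowP => j; rewrite !mxE.
case: j => -[|[|[|//]]] lt /=; rewrite ?(mulr0, mulr1, add0r, addr0).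
- by congr (c _ _); apply: val_inj.
- by rewrite -[RHS]c1; congr (c _ _); apply: val_inj.
- by congr (c _ _); apply: val_inj.
Qed.

(** Common zeros are real as points of the projective plane, that is, up to a
    complex factor. *)
Definition real_common_zeros h := forall v : 'rV[R[i]]_3, v != 0 ->
  ev iota v F = 0 -> ev iota v h = 0 -> exists c w, v = c *: complexify w.

Lemma ev_complexify w h : ev iota (complexify w) h = (ev idfun w h)%:C.
Proof. by rewrite -[RHS]/(iota _) (ev_rmorph idfun iota). Qed.

(** A common zero is a complex multiple [c w] of a real vector; its coordinate
    along row 1 is [1], so [c] and then the abscissa are real. *)
Lemma real_root_chart_elim k h z : h \is ishomog1 k mdeg ->
  real_common_zeros h ->
  root (map_poly iota (chart_elim h)) z ->
  exists x (w : 'rV[R]_3), [/\ z = x%:C, ev idfun w F = 0, ev idfun w h = 0,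
    (w *m N) 0 1 != 0 & (w *m N) 0 2 = x * (w *m N) 0 1].
Proof.
move=> hh real /root_chart_elim[y [Fy hy]].
have v0 : chart z y != 0.
  apply/eqP => v0; have := chart_coord1 z y; rewrite v0 mul0mx mxE.
  by move/eqP; rewrite eq_sym oner_eq0.
have [c [w vE]] := real _ v0 Fy hy.
have c0 : c != 0 by apply: contraNneq v0 => c0; rewrite vE c0 scale0r.
have e1 : c * ((w *m N) 0 1)%:C = 1.
  by rewrite -(chart_coord1 z y) vE -scalemxAl -complexify_mul [RHS]mxE [in RHS]mxE.
have e2 : c * ((w *m N) 0 2)%:C = z.
  by rewrite -[RHS](chart_coord2 z y) vE -scalemxAl -complexify_mul [RHS]mxE [in RHS]mxE.
have n1 : (w *m N) 0 1 != 0.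
  by apply: contra_eq_neq e1 => ->; rewrite mulr0 eq_sym oner_neq0.
exists ((w *m N) 0 2 / (w *m N) 0 1), w; split=> //; last by rewrite mulfVK.
- rewrite rmorphM fmorphV /= -e2 -[c]mulr1.
  rewrite -[X in c * X](mulfV (x := ((w *m N) 0 1)%:C)) ?fmorph_eq0//.
  by rewrite mulrA e1 mul1r mulrC.
- move: Fy; rewrite vE (ev_scale _ _ _ hF) ev_complexify => /eqP.
  by rewrite mulf_eq0 expf_eq0 (negbTE c0) andbF /= fmorph_eq0 => /eqP.
- move: hy; rewrite vE (ev_scale _ _ _ hh) ev_complexify => /eqP.
  by rewrite mulf_eq0 expf_eq0 (negbTE c0) andbF /= fmorph_eq0 => /eqP.
Qed.

Lemma root_chart_elim_real k h (w : 'rV[R]_3) : h \is ishomog1 k mdeg ->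
  ev idfun w F = 0 -> ev idfun w h = 0 -> (w *m N) 0 1 != 0 ->
  root (chart_elim h) ((w *m N) 0 2 / (w *m N) 0 1).
Proof.
move=> hh Fw hw n1; rewrite -(fmorph_root iota); apply/root_chart_elim.
set a := (w *m N) 0 1 in n1 *.
have E := chart_of_coords (w := complexify (a^-1 *: w)).
have wE j : (complexify (a^-1 *: w) *m map_mx (real_complex R) N) 0 j =
    (a^-1 * (w *m N) 0 j)%:C by rewrite -complexify_mul -scalemxAl [LHS]mxE [in LHS]mxE.
rewrite /= !wE mulVf// in E.
exists (a^-1 * (w *m N) 0 0)%:C; rewrite mulrC -E// !ev_complexify.
by rewrite (ev_scale _ _ _ hF) (ev_scale _ _ _ hh) Fw hw !mulr0.
Qed.

(** The zero polynomial would have the non-real root ['i]. *)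
Lemma chart_elim_neq0 k h : h \is ishomog1 k mdeg -> real_common_zeros h ->
  chart_elim h != 0.
Proof.
move=> hh real; apply/eqP => N0.
have [|x [w [/eqP]]] := real_root_chart_elim (z := 'i) hh real.
  by rewrite N0 rmorph0 root0.
by rewrite eq_complex /= eq_sym oner_eq0 andbF.
Qed.

End Chart.

(** * Weak Bezout theorem and persistence of zeros *)

(** Quantified over the sequence [u] so as to give non-roots both among the
    integers and arbitrarily close to a given point. *)
Lemma ex_nonroot_seq (K : idomainType) (u : nat -> K) (p : {poly K}) :
  injective u -> p != 0 -> exists n, ~~ root p (u n).
Proof.
move=> u_inj p0; pose rs := [seq u i | i <- iota 0 (size p)].
have [rs_roots|] := boolP (all (root p) rs).
  have := max_poly_roots p0 rs_roots.
  by rewrite map_inj_uniq// iota_uniq size_map size_iota ltnn => /(_ isT).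
by rewrite -has_predC => /hasP[_ /mapP[n _ ->] /= nr]; exists n.
Qed.

Lemma ex_nonroot_all (K : numDomainType) (ps : seq {poly K}) :
  {in ps, forall p, p != 0} -> exists x, {in ps, forall p, p.[x] != 0}.
Proof.
move=> ps0; have [||n] := @ex_nonroot_seq K (fun n => n%:R) (\prod_(p <- ps) p).
- by move=> m n /eqP; rewrite eqr_nat => /eqP.
- by rewrite prodf_seq_neq0; apply/allP => p /ps0.
rewrite /root horner_prod prodf_seq_neq0 => /allP nz.
by exists n%:R => p /nz.
Qed.

Section GenericChart.
Variable (R : rcfType).
Implicit Types (Q N : 'M[R]_3) (w p : 'rV[R]_3).

Lemma ex_chart_row0 w : w != 0 -> exists Q N, Q *m N = 1%:M /\ row 0 Q = w.
Proof.
move=> w0; have rk1 : \rank w = 1%N.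
  by apply/eqP; rewrite eqn_leq rank_leq_row lt0n mxrank_eq0.
pose c := col_ebase w 0 0.
have wE : w = c *: row 0 (row_ebase w).
  rewrite -[LHS]mulmx_ebase rk1 [col_ebase w]mx11_scalar -/c mul_scalar_mx.
  rewrite -scalemxAl; congr (_ *: _).
  by rewrite rowE; congr (_ *m _); apply/rowP => j; rewrite !mxE /= andbT eq_sym.
have c0 : c != 0 by apply: contraNneq w0 => c0; rewrite wE c0 scale0r.
exists (c *: row_ebase w), (c^-1 *: invmx (row_ebase w)).
rewrite -scalemxAl -scalemxAr scalerA mulfV// scale1r mulmxV ?row_ebase_unit//.
by split=> //; rewrite linearZ.
Qed.

(** Elementary operations on the coordinates act contragrediently on the basis. *)
Lemma shear_chart Q N (i j : 'I_3) a : i != j -> Q *m N = 1%:M ->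
  exists Q' N', [/\ Q' *m N' = 1%:M,
    forall w l, (w *m N') 0 l = (w *m N) 0 l + (l == j)%:R * (a * (w *m N) 0 i) &
    forall l, row l Q' = row l Q - (l == i)%:R *: (a *: row j Q)].
Proof.
move=> ij QN; pose E : 'M[R]_3 := a *: delta_mx i j.
have EE : E *m E = 0.
  by rewrite -scalemxAl -scalemxAr mul_delta_mx_0 ?scaler0// eq_sym.
exists ((1%:M - E) *m Q), (N *m (1%:M + E)); split=> [|w l|l].
- rewrite mulmxA -(mulmxA _ Q) QN mulmx1 mulmxDr mulmx1 mulmxBl mul1mx EE subr0.
  by rewrite subrK.
- rewrite mulmxA mulmxDr mulmx1 mxE; congr (_ + _).
  rewrite -scalemxAr mxE mulrCA; congr (_ * _).
  rewrite mxE (bigD1 i)//= big1 ?addr0 => [|k ki].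
    by rewrite [delta_mx _ _ _ _]mxE eqxx mulrC.
  by rewrite [delta_mx _ _ _ _]mxE (negbTE ki) mulr0.
- rewrite mulmxBl mul1mx linearB /=; congr (_ - _).
  rewrite -scalemxAl linearZ /= [RHS]scalerA mulrC -scalerA; congr (_ *: _).
  apply/rowP => k; rewrite !mxE (bigD1 j)//= big1 ?addr0 => [|m mj].
    by rewrite !mxE eqxx andbT.
  by rewrite mxE (negbTE mj) andbF mul0r.
Qed.

Lemma row_coords Q N w : Q *m N = 1%:M ->
  w = (w *m N) 0 0 *: row 0 Q + (w *m N) 0 1 *: row 1 Q + (w *m N) 0 2 *: row 2 Q.
Proof.
move=> /mulmx1C NQ; rewrite -[LHS]mulmx1 -NQ mulmxA mulmx_sum_row.
rewrite !big_ord_recl big_ord0 addr0 addrA.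
by congr (_ *: row _ Q + _ *: row _ Q + _ *: row _ Q); try congr (_ 0 _);
  apply: val_inj.
Qed.

Definition pairwise_nonproportional (ps : seq 'rV[R]_3) := uniq ps /\
  {in ps &, forall p p', p != p' -> forall a, p' != a *: p}.

(** Only finitely many shears are bad.  The first one makes the coordinate along
    row 1 non-zero at all the points, which is possible as none of them is the
    centre [D]; the second one moves the centre off the lines joining two of the
    points, while keeping it off the curve. *)
Lemma generic_chart d (F : mpoly 3 R) D (ps : seq 'rV[R]_3) :
  F \is ishomog1 d mdeg -> ev idfun D F != 0 -> D != 0 ->
  {in ps, forall p, p != 0 /\ ev idfun p F = 0} ->
  pairwise_nonproportional ps ->
  exists Q N, [/\ Q *m N = 1%:M, ev idfun (row 0 Q) F != 0,
    {in ps, forall p, (p *m N) 0 1 != 0} &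
    {in ps &, forall p p', p != p' ->
      (p *m N) 0 2 / (p *m N) 0 1 != (p' *m N) 0 2 / (p' *m N) 0 1}].
Proof.
move=> hF FD D0 zps [_ ndist].
have [Q0 [N0 [QN0 rD]]] := ex_chart_row0 D0.
have [|s hs] := @ex_nonroot_all R
    [seq ((p *m N0) 0 1)%:P + (p *m N0) 0 2 *: 'X | p <- ps].
  move=> _ /mapP[p pps ->]; have [p0 Fp] := zps p pps.
  apply/eqP => /polyP e; move: (e 0%N) (e 1%N).
  rewrite !(coefD, coefC, coefZ, coefX, coef0) /= mulr0 addr0 mulr1 add0r => b0 c0.
  have := row_coords p QN0; rewrite b0 c0 !scale0r !addr0 rD => pE.
  move: Fp; rewrite pE (ev_scale _ _ _ hF) => /eqP; rewrite mulf_eq0 (negbTE FD).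
  rewrite orbF expf_eq0 => /andP[_ /eqP a0].
  by move: p0; rewrite pE a0 scale0r eqxx.
have [|Q1 [N1 [QN1 co1 row1]]] := @shear_chart Q0 N0 2 1 s _ QN0; first by [].
have n1 : {in ps, forall p, (p *m N1) 0 1 != 0}.
  move=> p pps; have := hs _ (map_f _ pps).
  by rewrite co1 eqxx mul1r !hornerE mulrC.
pose pr p p' := ((p *m N1) 0 2 * (p' *m N1) 0 1 - (p' *m N1) 0 2 * (p *m N1) 0 1)%:P
  - ((p *m N1) 0 0 * (p' *m N1) 0 1 - (p' *m N1) 0 0 * (p *m N1) 0 1) *: 'X.
have [|r hr] := @ex_nonroot_all R (along idfun (row 0 Q1) (row 2 Q1) F ::
   [seq pr q.1 q.2 | q <- [seq (p, p') | p <- ps, p' <- ps] & q.1 != q.2]).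
  move=> _ /[!inE] /orP[/eqP ->|/mapP[[p p'] + ->]].
    apply: contraNneq FD => a0; rewrite -rD.
    have -> : row 0 Q0 = row 0 Q1 + 0 *: row 2 Q1.
      by rewrite row1 scale0r /= scale0r subr0 addr0.
    by rewrite -along_horner a0 horner0.
  rewrite mem_filter /= => /andP[pp' /allpairsP[[q q'] /= [qps q'ps [pE p'E]]]].
  subst p p'.
  apply/eqP => /polyP e; move: (e 0%N) (e 1%N).
  rewrite !(coefB, coefC, coefZ, coefX, coef0) /= mulr0 subr0 mulr1 sub0r.
  move=> /eqP + /eqP; rewrite oppr_eq0 !subr_eq0 => /eqP e2 /eqP e0.
  have nq := n1 _ qps.
  have := ndist _ _ qps q'ps pp' ((q' *m N1) 0 1 / (q *m N1) 0 1).
  case/eqP; rewrite [LHS](row_coords _ QN1) {2}(row_coords q QN1).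
  rewrite !scalerDr !scalerA; congr (_ *: _ + _ *: _ + _ *: _).
  - by apply: (mulIf nq); rewrite -e0 mulrAC divfK// mulrC.
  - by rewrite divfK.
  - by apply: (mulIf nq); rewrite -e2 mulrAC divfK// mulrC.
have [|Q2 [N2 [QN2 co2 row2]]] := @shear_chart Q1 N1 0 2 (- r) _ QN1; first by [].
have c1 p : (p *m N2) 0 1 = (p *m N1) 0 1 by rewrite co2 mul0r addr0.
exists Q2, N2; split=> // [|p pps|p p' pps p'ps pp'].
- have := hr (along idfun (row 0 Q1) (row 2 Q1) F); rewrite inE eqxx => /(_ isT).
  by rewrite along_horner row2 eqxx scale1r scaleNr opprK.
- by rewrite c1 n1.
have /hr : pr p p' \in along idfun (row 0 Q1) (row 2 Q1) F ::
   [seq pr q.1 q.2 | q <- [seq (p, p') | p <- ps, p' <- ps] & q.1 != q.2].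
  rewrite inE; apply/orP; right; apply/mapP; exists (p, p') => //.
  by rewrite mem_filter pp' /=; apply/allpairsP; exists (p, p').
move=> nz; rewrite !c1 eqr_div ?n1// !co2 eqxx !mul1r -subr_eq0.
by apply: contraNneq nz => e; apply/eqP; rewrite /pr !hornerE -[RHS]e; ring.
Qed.

Variables (d : nat) (F : mpoly 3 R) (D : 'rV[R]_3).
Hypothesis hF : F \is ishomog1 d.+1 mdeg.
Hypotheses (FD : ev idfun D F != 0) (D0 : D != 0).

Definition common_zeros h (ps : seq 'rV[R]_3) := pairwise_nonproportional ps /\
  {in ps, forall p, [/\ p != 0, ev idfun p F = 0 & ev idfun p h = 0]}.

(** In a generic chart the points have distinct abscissas, all of them roots of a
    non-zero polynomial. *)
Theorem bezout k h ps : h \is ishomog1 k mdeg -> real_common_zeros F h ->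
  common_zeros h ps -> (size ps <= k * d.+1)%N.
Proof.
move=> hh real [ndist zps].
have [|Q [N [QN FQ n1 x_inj]]] := generic_chart hF FD D0 _ ndist.
  by move=> p /zps[].
pose x p := (p *m N) 0 2 / (p *m N) 0 1.
have x_injps : {in ps &, injective x}.
  by move=> p p' pps p'ps; apply: contra_eq => /x_inj; exact.
have N0 := chart_elim_neq0 QN hF FQ hh real.
have := max_poly_roots (rs := map x ps) N0; rewrite size_map => lt.
rewrite -ltnS (leq_trans (lt _ _) (size_chart_elim Q hF hh))//.
- apply/allP => _ /mapP[p pps ->]; have [_ Fp hp] := zps _ pps.
  exact: root_chart_elim_real hh Fp hp (n1 _ pps).
- by rewrite map_inj_in_uniq// ndist.1.
Qed.

(** Bezout bounds the length of such lists, and a list that misses a zero can be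
    extended. *)
Lemma complete_common_zeros k h p : h \is ishomog1 k mdeg ->
  real_common_zeros F h -> p != 0 -> ev idfun p F = 0 -> ev idfun p h = 0 ->
  exists ps, [/\ common_zeros h ps, p \in ps &
    forall q, q != 0 -> ev idfun q F = 0 -> ev idfun q h = 0 ->
      exists2 p', p' \in ps & exists a, q = a *: p'].
Proof.
move=> hh real p0 Fp hp.
suff ext m ps : common_zeros h ps -> p \in ps -> (k * d.+1 - size ps < m)%N ->
    exists ps, [/\ common_zeros h ps, p \in ps &
      forall q, q != 0 -> ev idfun q F = 0 -> ev idfun q h = 0 ->
        exists2 p', p' \in ps & exists a, q = a *: p'].
  apply: (ext _ [:: p]) (ltnSn _); last exact: mem_head.
  split; last by move=> q; rewrite inE => /eqP ->.
  by split=> // q q'; rewrite !inE => /eqP -> /eqP ->; rewrite eqxx.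
elim: m ps => // m IH ps psP pps lt.
have [max|] := EM (forall q, q != 0 -> ev idfun q F = 0 -> ev idfun q h = 0 ->
    exists2 p', p' \in ps & exists a, q = a *: p'); first by exists ps.
move=> /existsNP[q] /not_implyP[q0] /not_implyP[Fq] /not_implyP[hq nq].
have [[ups ndist] zps] := psP.
have nqa p' a : p' \in ps -> q != a *: p'.
  by move=> p'ps; apply/eqP => qE; apply: nq; exists p' => //; exists a.
have qpsP : common_zeros h (q :: ps).
  split; last by move=> p' /[!inE] /orP[/eqP ->|/zps].
  split=> [|p1 p2].
    by rewrite /= ups andbT; apply/negP => /(nqa _ 1); rewrite scale1r eqxx.
  rewrite !inE => /orP[/eqP ->|p1s] /orP[/eqP ->|p2s]; first by rewrite eqxx.
  - move=> _ a; apply/eqP => p2E; have [p20 _ _] := zps _ p2s.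
    have a0 : a != 0 by apply: contraNneq p20 => a0; rewrite p2E a0 scale0r.
    by have := nqa _ a^-1 p2s; rewrite p2E scalerA mulVf// scale1r eqxx.
  - by move=> _ a; exact: nqa.
  - exact: ndist.
apply: (IH (q :: ps)) => //; first by rewrite inE pps orbT.
by have := bezout hh real qpsP; rewrite /=; lia.
Qed.

(** The polynomial splits over the reals, and for each root [r] the assumptions
    give [`|x1 - r| <= 2 `|x0 - r|]. *)
Lemma real_rooted_bound n (p : {poly R}) x0 x1 eps :
  (size p <= n.+1)%N ->
  (forall z : R[i], root (map_poly (real_complex R) p) z -> exists x, z = x%:C) ->
  (forall x, root p x -> eps <= `|x - x0|) -> `|x1 - x0| <= eps ->
  `|p.[x1]| <= 2 ^+ n * `|p.[x0]|.
Proof.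
move=> sp realp far near.
have [->|p0] := eqVneq p 0; first by rewrite !horner0 normr0 mulr0.
have [rs pE] := closed_field_poly_normal (map_poly (real_complex R) p).
have lp0 : lead_coef (map_poly (real_complex R) p) != 0.
  by rewrite lead_coef_eq0 map_poly_eq0.
pose xs := [seq complex.Re z | z <- rs].
have rsE : rs = map (real_complex R) xs.
  rewrite -map_comp -[LHS]map_id; apply/eq_in_map => z zrs.
  have [|x ->//] := realp z.
  by rewrite pE rootZ// root_prod_XsubC.
have {}pE : p = lead_coef p *: \prod_(x <- xs) ('X - x%:P).
  apply: (map_poly_inj (real_complex R)).
  rewrite map_polyZ /= rmorph_prod {1}pE lead_coef_map rsE big_map.
  congr (_ *: _); apply: eq_bigr => x _.
  by rewrite rmorphB /= map_polyX map_polyC.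
have lc0 : lead_coef p != 0 by rewrite lead_coef_eq0.
have sxs : (size xs <= n)%N.
  by move: sp; rewrite pE size_scale// size_prod_XsubC.
rewrite pE !hornerZ !horner_prod !normrM mulrCA ler_wpM2l// !normr_prod.
apply: (@le_trans _ _ (2 ^+ size xs * \prod_(x <- xs) `|('X - x%:P).[x0]|)).
  have -> : 2 ^+ size xs = \prod_(x <- xs) (2 : R).
    by rewrite big_const_seq count_predT iter_mulr_1.
  rewrite -big_split big_seq [leRHS]big_seq; apply: ler_prod => x xxs.
  rewrite normr_ge0 /= !hornerXsubC.
  have : eps <= `|x - x0|.
    by apply: far; rewrite pE rootZ// root_prod_XsubC.
  move: near; rewrite -(opprB x0 x) normrN => near far_x.
  rewrite (_ : x1 - x = (x1 - x0) + (x0 - x)); last by ring.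
  rewrite (le_trans (ler_normD _ _))// mulr_natl mulr2n lerD2r.
  exact: le_trans far_x.
by rewrite ler_wpM2r ?prodr_ge0// ler_weXn2l// ler1n.
Qed.

(** Choose a chart where the finitely many zeros of the member [t0] have distinct
    abscissas; [p] is then the only one with abscissa [x0].  The values at [x0]
    and at a nearby [x1] of the elimination polynomial are polynomials in [t].
    At [t0] the first one vanishes and the second does not, so for [t] near [t0]
    [real_rooted_bound] forces a root close to [x0].
    Polynomials [q0] and [q1] express this nearness algebraically. *)
Lemma zero_persists k G H t0 p :
  G \is ishomog1 k mdeg -> H \is ishomog1 k mdeg ->
  (forall t, real_common_zeros F (G + t *: H)) ->
  p != 0 -> ev idfun p F = 0 -> ev idfun p (G + t0 *: H) = 0 ->
  exists N x0,
    (forall q, q != 0 -> ev idfun q F = 0 -> ev idfun q (G + t0 *: H) = 0 ->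
      (q *m N) 0 2 = x0 * (q *m N) 0 1 -> exists a, q = a *: p) /\
    forall eps, 0 < eps -> exists q0 q1 : {poly R}, [/\ root q0 t0, ~~ root q1 t0 &
      forall t, `|q0.[t]| < `|q1.[t]| -> exists w, [/\ w != 0, ev idfun w F = 0,
        ev idfun w (G + t *: H) = 0 &
        `|(w *m N) 0 2 - x0 * (w *m N) 0 1| < eps * `|(w *m N) 0 1| ]].
Proof.
move=> hG hH real p0 Fp hp.
have hh t : G + t *: H \is ishomog1 k mdeg by rewrite rpredD// rpredZ.
have [ps [psP pps max]] := complete_common_zeros (hh t0) (real t0) p0 Fp hp.
have [ndist zps] := psP.
have [|Q [N [QN FQ n1 x_inj]]] := generic_chart hF FD D0 _ ndist.
  by move=> q /zps[].
pose x (q : 'rV[R]_3) := (q *m N) 0 2 / (q *m N) 0 1.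
exists N, (x p); split=> [q q0 Fq hq qN|eps eps0].
  have [p' p'ps [a qE]] := max q q0 Fq hq; exists a.
  have a0 : a != 0 by apply: contraNneq q0 => a0; rewrite qE a0 scale0r.
  suff -> : p = p' by [].
  apply/eqP; apply: contraT => /(x_inj _ _ pps p'ps)/negP[].
  apply/eqP/esym; rewrite -/(x p).
  have qNE l : (q *m N) 0 l = a * (p' *m N) 0 l.
    by rewrite qE -scalemxAl [LHS]mxE.
  by move: qN; rewrite !qNE mulrCA => /(mulfI a0) ->; rewrite mulfK// n1.
set n := (k * d.+1)%N.
pose E t := chart_elim Q d F (G + t *: H).
have Ereal t z : root (map_poly (real_complex R) (E t)) z -> exists x, z = x%:C.
  case/(real_root_chart_elim QN hF FQ (hh t) (real t)) => x' [w [-> _ _ _ _]].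
  by exists x'.
pose u (j : nat) : R := x p + eps / j.+1%:R.
have u_inj : injective u.
  move=> i j /addrI /(mulfI (lt0r_neq0 eps0)) /invr_inj /eqP.
  by rewrite eqr_nat => /eqP[].
have [j Ej] := ex_nonroot_seq u_inj (chart_elim_neq0 QN hF FQ (hh t0) (real t0)).
have [r0 r0E] := chart_elim_pencil Q d F G H (x p).
have [r1 r1E] := chart_elim_pencil Q d F G H (u j).
exists (2 ^+ n *: r0), r1; split.
- rewrite /root hornerZ -r0E mulf_eq0; apply/orP; right.
  exact: root_chart_elim_real (hh t0) Fp hp (n1 _ pps).
- by rewrite /root -r1E.
move=> t; rewrite hornerZ -r0E -r1E normrM (ger0_norm (exprn_ge0 _ _))// => lt.
have [near|far] := EM (exists2 y, root (E t) y & `|y - x p| < eps).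
  have [y Ey ye] := near.
  have : root (map_poly (real_complex R) (E t)) y%:C by rewrite fmorph_root.
  case/(real_root_chart_elim QN hF FQ (hh t) (real t)) => y' [w [[<-] Fw hw w1 w2]].
  exists w; split=> //.
    by apply: contraNneq w1 => ->; rewrite mul0mx mxE.
  by rewrite w2 -mulrBl normrM ltr_pM2r// normr_gt0.
suff : `|(E t).[u j]| <= 2 ^+ n * `|(E t).[x p]| by rewrite leNgt lt.
apply: (real_rooted_bound (size_chart_elim Q hF (hh t)) (Ereal t) (eps := eps)).
  by move=> y Ey; rewrite leNgt; apply/negP => ye; apply: far; exists y.
rewrite /u addrAC subrr add0r normrM normfV (gtr0_norm eps0) normr_nat.
by rewrite ler_pdivrMr ?ltr0n// ler_peMr ?(ltW eps0)// ler1n.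
Qed.

End GenericChart.

(** * Lines and smooth curves *)

Section Lines.
Variables (R : rcfType) (d : nat) (F : mpoly 3 R).
Hypothesis hF : F \is ishomog1 d.+1 mdeg.
Let iota : {rmorphism R -> R[i]} := real_complex R.
Implicit Types (p w : 'rV[R]_3).

Definition smooth := forall v : 'rV[R[i]]_3, v != 0 -> ev iota v F = 0 ->
  exists j, ev iota v (mderiv j F) != 0.

(** The form restricted to the line would have more roots than its degree.  A
    shear inside the line keeps all the given points away from infinity. *)
Lemma line_in_curve (Q N : 'M[R]_3) (ps : seq 'rV[R]_3) : Q *m N = 1%:M ->
  pairwise_nonproportional ps ->
  {in ps, forall p, [/\ p != 0, ev idfun p F = 0 & (p *m N) 0 2 = 0]} ->
  (d.+1 < size ps)%N ->
  exists Q' N' : 'M[R]_3, Q' *m N' = 1%:M /\ along idfun (row 1 Q') (row 0 Q') F = 0.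
Proof.
move=> QN [ups ndist] zps sps.
have [|s hs] := @ex_nonroot_all R
    [seq ((p *m N) 0 1)%:P + (p *m N) 0 0 *: 'X | p <- ps].
  move=> _ /mapP[p pps ->]; have [p0 _ p2] := zps p pps.
  apply/eqP => /polyP e; move: (e 0%N) (e 1%N).
  rewrite !(coefD, coefC, coefZ, coefX, coef0) /= mulr0 addr0 mulr1 add0r => c1 c0.
  by move: p0; rewrite (row_coords p QN) c0 c1 p2 !scale0r !addr0 eqxx.
have [|Q' [N' [QN' co _]]] := @shear_chart R Q N 0 1 s _ QN; first by [].
exists Q', N'; split=> //; apply/eqP; apply: contraT => al0.
have n1 : {in ps, forall p, (p *m N') 0 1 != 0}.
  move=> p pps; have := hs _ (map_f _ pps).
  by rewrite co eqxx mul1r !hornerE mulrC.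
have rowE : {in ps, forall p, p = (p *m N') 0 1 *:
    (row 1 Q' + ((p *m N') 0 0 / (p *m N') 0 1) *: row 0 Q')}.
  move=> p pps; have [_ _ p2] := zps p pps.
  rewrite [LHS](row_coords p QN') [X in X *: row 2 _]co p2 /= mul0r addr0 scale0r.
  by rewrite addr0 scalerDr scalerA mulrCA mulfV ?n1// mulr1 addrC.
pose x (p : 'rV[R]_3) := (p *m N') 0 0 / (p *m N') 0 1.
have x_inj : {in ps &, injective x}.
  move=> p p' pps p'ps; rewrite /x => e; apply/eqP; apply: contraT => ne.
  have := ndist _ _ pps p'ps ne ((p' *m N') 0 1 / (p *m N') 0 1).
  case/eqP; set b := (p *m N') 0 1; set b' := (p' *m N') 0 1.
  have pE := rowE p pps; rewrite [LHS](rowE p' p'ps) -e -/b'.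
  transitivity ((b' / b) *: (b *: (row 1 Q' + ((p *m N') 0 0 / b) *: row 0 Q'))).
    by rewrite scalerA divfK ?n1.
  by congr (_ *: _).
have := max_poly_roots (rs := map x ps) al0; rewrite size_map => lt.
have [sal _] := size_along idfun (row 1 Q') (row 0 Q') hF.
suff : (size ps < d.+2)%N by rewrite ltnNge sps.
rewrite (leq_trans (lt _ _))//; last by rewrite map_inj_in_uniq.
apply/allP => _ /mapP[p pps ->]; rewrite /root along_horner.
have [_ Fp _] := zps p pps; move/eqP: Fp.
rewrite {1}(rowE p pps) (ev_scale _ _ _ hF) mulf_eq0 expf_eq0.
by rewrite (negbTE (n1 p pps)) andbF.
Qed.

(** On a line contained in the curve the derivatives of [F] along the line
    vanish.  The derivative in a transverse direction is a form of positive
    degree [d] on the line, so it has a complex zero, which is a singular point. *)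
Lemma smooth_no_line (Q N : 'M[R]_3) : (0 < d)%N -> smooth -> Q *m N = 1%:M ->
  along idfun (row 1 Q) (row 0 Q) F != 0.
Proof.
move=> d0 sm QN; apply/eqP => al0.
pose v0 := complexify (row 0 Q); pose v1 := complexify (row 1 Q).
have alC : along iota v1 v0 F = 0.
  transitivity (map_poly iota (along idfun (row 1 Q) (row 0 Q) F)); last first.
    by rewrite al0 rmorph0.
  rewrite [RHS](@ev_rmorph _ _ _ (polyC \o idfun) _ (map_poly iota)) /along.
  rewrite (eq_ev (phi' := map_poly iota \o (polyC \o idfun))) => [|a]; last first.
    by rewrite /= map_polyC.
  congr ev; apply/rowP => j; rewrite !mxE rmorphD rmorphM /= map_polyX !map_polyC.
  by [].
have Fspan a b : ev iota (a *: v0 + b *: v1) F = 0.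
  have [->|b0] := eqVneq b 0.
    rewrite scale0r addr0 (ev_scale _ _ _ hF).
    have [_ <-] := size_along iota v1 v0 hF.
    by rewrite alC coef0 mulr0.
  have -> : a *: v0 + b *: v1 = b *: (v1 + (a / b) *: v0).
    by rewrite scalerDr scalerA mulrCA mulfV// mulr1 addrC.
  by rewrite (ev_scale _ _ _ hF) -along_horner alC horner0 mulr0.
pose H := \sum_j row 2 Q 0 j *: mderiv j F.
have hH : H \is ishomog1 d mdeg.
  by apply: rpred_sum => j _; rewrite rpredZ// (dhomog_mderiv _ hF).
have indep a b : (a != 0) || (b != 0) -> a *: v0 + b *: v1 != 0.
  move=> ab; apply/eqP => e.
  have rowN j : complexify (row j Q) *m map_mx (real_complex R) N = delta_mx 0 j.
    rewrite -[LHS]map_mxM -row_mul QN row1; apply/rowP => i.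
    by rewrite !mxE rmorph_nat.
  have := congr1 (mulmx^~ (map_mx (real_complex R) N)) e.
  rewrite /v0 /v1 mulmxDl -!scalemxAl !rowN mul0mx => /rowP eN.
  move: (eN 0) (eN 1) ab; rewrite !mxE /= !mulr0 !mulr1 addr0 add0r => -> ->.
  by rewrite eqxx.
have [a [b [ab Hab]]] : exists a b, (a != 0) || (b != 0) /\
    ev iota (a *: v0 + b *: v1) H = 0.
  have [sr cr] := size_along iota v1 v0 hH.
  (* A restriction of size 1 has no affine zero, but as [0 < d] its coefficient
     of index [d] vanishes: the zero is at infinity. *)
  have [/eqP s1|] := boolP (size (along iota v1 v0 H) == 1%N).
    exists 1, 0; rewrite oner_eq0 scale1r scale0r addr0 -cr; split=> //.
    by rewrite nth_default// s1.
  case/closed_rootP => z /rootP Hz; exists z, 1; rewrite oner_eq0 orbT; split=> //.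
  by rewrite scale1r addrC -along_horner.
set v := _ + _ in Hab; have v_neq0 : v != 0 := indep _ _ ab.
pose grad : 'cV[R[i]]_3 := \col_j ev iota v (mderiv j F).
have dir0 (w : 'rV[R[i]]_3) : (forall e, ev iota (v + e *: w) F = 0) -> w *m grad = 0.
  move=> Fw; apply/rowP => j; rewrite !ord1 [RHS]mxE.
  have al : along iota v w F = 0.
    apply/eqP; apply: contraT => /(@ex_nonroot_seq _ (fun n => n%:R))[|n].
      by move=> m n /eqP; rewrite eqr_nat => /eqP.
    by rewrite /root along_horner Fw eqxx.
  have := deriv_along0 iota v w F; rewrite al deriv0 horner0 => ->.
  by rewrite mxE; apply: eq_bigr => i _; rewrite mxE.
have g0 : v0 *m grad = 0.
  apply: dir0 => e; rewrite /v addrAC -scalerDl; exact: Fspan.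
have g1 : v1 *m grad = 0.
  apply: dir0 => e; rewrite /v -addrA -scalerDl; exact: Fspan.
have g2 : complexify (row 2 Q) *m grad = 0.
  apply/rowP => j; rewrite !ord1 mxE [RHS]mxE -[RHS]Hab /ev /H raddf_sum /=.
  by apply: eq_bigr => i _; rewrite !mxE [RHS]evZ.
have Qgrad : map_mx (real_complex R) Q *m grad = 0.
  apply/row_matrixP => i; rewrite row_mul row0 -map_row.
  have [->|[->|->]] // : i = 0 \/ i = 1 \/ i = 2.
  by case: i => -[|[|[|//]]] lt; [left | right; left | right; right]; apply: val_inj.
have grad0 : grad = 0.
  have Qu : map_mx (real_complex R) Q \in unitmx.
    by rewrite map_unitmx; case/mulmx1_unit: QN.
  by rewrite -[LHS](mulKmx Qu) Qgrad mulmx0.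
have [j] := sm v v_neq0 (Fspan a b).
by have := congr1 (fun M : 'cV_3 => M j 0) grad0; rewrite !mxE => ->; rewrite eqxx.
Qed.

(** Some derivative of [F] at [w] is non-zero, so [F] does not vanish identically
    on the line through [w] in that direction. *)
Lemma smooth_nonzero_value w : smooth -> w != 0 -> ev idfun w F = 0 ->
  exists2 D, D != 0 & ev idfun D F != 0.
Proof.
move=> sm w0 Fw.
have [||j] := sm (complexify w); first by rewrite map_mx_eq0.
  by rewrite ev_complexify Fw.
rewrite ev_complexify fmorph_eq0 => dF.
pose e : 'rV[R]_3 := delta_mx 0 j.
have : along idfun w e F != 0.
  apply: contraNneq dF => al0; have := deriv_along0 idfun w e F.
  rewrite al0 deriv0 horner0 (bigD1 j)//= big1 => [|i ij].
    by rewrite mxE !eqxx mul1r addr0 => <-.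
  by rewrite mxE (negbTE ij) mul0r.
case/(@ex_nonroot_seq _ (fun n => n%:R)) => [m n /eqP|n].
  by rewrite eqr_nat => /eqP.
rewrite /root along_horner => FD; exists (w + n%:R *: e) => //.
apply: contraNneq FD => ->.
have -> : (0 : 'rV[R]_3) = 0 *: w by rewrite scale0r.
by rewrite (ev_scale _ _ _ hF) exprS !mul0r.
Qed.

End Lines.

(** * Continuity and compactness *)

(** The tube lemma. *)
Lemma closed_projection (X Y : topologicalType) (K : set X) (Z : set (X * Y)) :
  compact K -> closed Z -> closed [set y | exists2 x, K x & Z (x, y)].
Proof.
move=> /compact_near_coveringP cK /closed_openC oZ.
rewrite -openC openE => y /= nKZ; rewrite /interior.
have near_Z : \forall y' \near y, K `<=` (fun x' => ~ Z (x', y')).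
  apply: (cK Y (nbhs y) (fun y' x' => ~ Z (x', y'))) => x Kx.
  have : nbhs (x, y) (~` Z).
    by apply: open_nbhs_nbhs; split=> // Zxy; apply: nKZ; exists x.
  by apply: filterS => -[x' y'].
by apply: filterS near_Z => y' KZ [x Kx Zxy]; exact: KZ Kx Zxy.
Qed.

Lemma closed_zeros (R : realType) (T : topologicalType) (phi : T -> R) :
  continuous phi -> closed [set x | phi x = 0].
Proof.
move=> cphi; apply: (@preimage_closed _ _ phi [set y | y = 0]); last exact: closed_eq.
by move=> x _; exact: cphi.
Qed.

Lemma closed_nonneg (R : realType) (T : topologicalType) (phi : T -> R) :
  continuous phi -> closed [set x | 0 <= phi x].
Proof.
move=> cphi; apply: (@preimage_closed _ _ phi [set y | 0 <= y]); last exact: closed_ge.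
by move=> x _; exact: cphi.
Qed.

Lemma connected_line (R : realType) : connected [set: R].
Proof. by apply/connected_intervalP => x y _ _ z _. Qed.

Section ContinuousBig.
Variables (R : realType) (T : topologicalType) (I : Type) (f : I -> T -> R).
Hypothesis cf : forall i, continuous (f i).

Lemma continuous_sum_seq s : continuous (fun x => \sum_(i <- s) f i x).
Proof.
elim: s => [|i s IH].
  rewrite (_ : (fun x => _) = cst 0); first exact: cst_continuous.
  by apply/funext => x; rewrite big_nil.
rewrite (_ : (fun x => _) = f i \+ (fun x => \sum_(i <- s) f i x)).
  by move=> x; apply: continuousD; [exact: cf | exact: IH].
by apply/funext => x; rewrite big_cons.
Qed.

Lemma continuous_prod_seq s : continuous (fun x => \prod_(i <- s) f i x).
Proof.
elim: s => [|i s IH].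
  rewrite (_ : (fun x => _) = cst 1); first exact: cst_continuous.
  by apply/funext => x; rewrite big_nil.
rewrite (_ : (fun x => _) = f i \* (fun x => \prod_(i <- s) f i x)).
  by move=> x; apply: continuousM; [exact: cf | exact: IH].
by apply/funext => x; rewrite big_cons.
Qed.

End ContinuousBig.

Lemma continuous_ev (R : realType) n (F : mpoly n R) :
  continuous (fun w : 'rV[R]_n => ev idfun w F).
Proof.
apply: continuous_sum_seq => m w; apply: (@continuousM _ _ (cst _) (fun w => mmap1 _ m)).
  exact: cst_continuous.
apply: continuous_prod_seq => j v.
by apply: (@continuous_comp _ _ _ (fun v : 'rV[R]_n => v 0 j) (fun x => x ^+ _));
  [exact: coord_continuous | exact: exprn_continuous].
Qed.

Lemma continuous_linear_form (R : realType) n m (A : 'M[R]_(n, m)) j :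
  continuous (fun w : 'rV[R]_n => (w *m A) 0 j).
Proof.
rewrite (_ : (fun w => _) = fun w : 'rV_n => \sum_i w 0 i * A i j).
  apply: continuous_sum_seq => i w.
  apply: (@continuousM _ _ (fun w : 'rV_n => w 0 i) (cst _)).
    exact: coord_continuous.
  exact: cst_continuous.
by apply/funext => w; rewrite mxE.
Qed.

Lemma continuous_ev_fst (R : realType) n (Y : topologicalType) (F : mpoly n R) :
  continuous (fun x : 'rV[R]_n * Y => ev idfun x.1 F).
Proof.
move=> x; apply: (@continuous_comp _ _ _ fst (fun w : 'rV[R]_n => ev idfun w F)).
  exact: cvg_fst.
exact: continuous_ev.
Qed.

Lemma continuous_linear_form_fst (R : realType) n m (Y : topologicalType)
    (A : 'M[R]_(n, m)) j :
  continuous (fun x : 'rV[R]_n * Y => (x.1 *m A) 0 j).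
Proof.
move=> x; apply: (@continuous_comp _ _ _ fst (fun w : 'rV[R]_n => (w *m A) 0 j)).
  exact: cvg_fst.
exact: continuous_linear_form.
Qed.

(** * A totally real pencil on the pieces of a real curve *)

(** Real points of the curve are represented by vectors on the unit sphere of
    the sup norm, which gives a compact set; each point has two representatives. *)
Definition unit_curve (R : realType) (F : mpoly 3 R) : set 'rV[R]_3 :=
  [set w | `|w| = 1 /\ ev idfun w F = 0].

Section Pieces.
Variables (R : realType) (d k l : nat) (F f g : mpoly 3 R) (D : 'rV[R]_3).
Hypothesis hF : F \is ishomog1 d.+1 mdeg.
Hypothesis hf : f \is ishomog1 k mdeg.
Hypothesis hg : g \is ishomog1 k mdeg.
Hypothesis D0 : D != 0.
Hypothesis FD : ev idfun D F != 0.
Hypothesis no_base : forall w : 'rV[R]_3, w != 0 -> ev idfun w F = 0 ->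
  ev idfun w f = 0 -> ev idfun w g = 0 -> False.
Hypothesis real_pencil : forall la mu : R, (la, mu) != (0, 0) ->
  real_common_zeros F (la *: f + mu *: g).
Variable c : 'rV[R]_3 -> 'I_l.
Definition piece i : set 'rV[R]_3 := unit_curve F `&` [set w | c w = i].
Hypothesis closed_piece : forall i, closed (piece i).
Hypothesis c_scale : forall w a, unit_curve F w -> unit_curve F (a *: w) ->
  c (a *: w) = c w.
Hypothesis piece_neq0 : forall i, piece i !=set0.

Lemma compact_piece i : compact (piece i).
Proof.
apply: bounded_closed_compact; last exact: closed_piece.
by exists 1; split=> // M M1 w [[w1 _] _]; move: M1; rewrite -{1}w1 => /ltW.
Qed.

Lemma compact_other_pieces i : compact (unit_curve F `&` [set w | c w != i]).
Proof.
apply: bounded_closed_compact.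
  by exists 1; split=> // M M1 w [[w1 _] _]; move: M1; rewrite -{1}w1 => /ltW.
rewrite (_ : _ `&` _ = \bigcup_(j in [set j | j != i]) piece j).
  by apply: closed_bigcup => [|j _]; [exact: finite_finset | exact: closed_piece].
apply/seteqP; split=> [w [Fw cw]|w [j ji [Fw cw]]]; last by split=> //=; rewrite cw.
by exists (c w).
Qed.

Lemma unit_curve_neq0 w : unit_curve F w -> w != 0.
Proof.
by move=> [w1 _]; apply/eqP => w0; move: w1; rewrite w0 normr0 => /esym/eqP; rewrite oner_eq0.
Qed.

Lemma normalize_zero w h m : h \is ishomog1 m mdeg ->
  w != 0 -> ev idfun w F = 0 -> ev idfun w h = 0 ->
  unit_curve F (`|w|^-1 *: w) /\ ev idfun (`|w|^-1 *: w) h = 0.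
Proof.
move=> hh w0 Fw hw; split; [split|].
- by rewrite normrZ normfV normr_id mulVf// normr_eq0.
- by rewrite (ev_scale _ _ _ hF) Fw mulr0.
- by rewrite (ev_scale _ _ _ hh) hw mulr0.
Qed.

Lemma pencil_homog la mu : la *: f + mu *: g \is ishomog1 k mdeg.
Proof. by rewrite rpredD// rpredZ. Qed.

Lemma ev_pencil la mu w :
  ev idfun w (la *: f + mu *: g) = la * ev idfun w f + mu * ev idfun w g.
Proof. by rewrite evD !evZ. Qed.

(** Along the line of parameters joining a member through a point of the piece to
    the given member, the parameters whose member meets the piece form a non-empty
    closed and open subset of the real line. *)
Theorem piece_meets_member i la mu : (la, mu) != (0, 0) ->
  exists2 w, piece i w & ev idfun w (la *: f + mu *: g) = 0.
Proof.
move=> lm0; have [w0 iw0] := piece_neq0 i.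
have [Fw0 _] := iw0; have w00 := unit_curve_neq0 Fw0.
pose la0 := ev idfun w0 g; pose mu0 := - ev idfun w0 f.
have [hw0|hw0] := eqVneq (ev idfun w0 (la *: f + mu *: g)) 0; first by exists w0.
(* The member [G + t H] goes from one through [w0] at [t = 0] to the given one
   at [t = 1]; its value at [w0] is [t] times that of the given one, so all
   these members are non-zero. *)
pose G := la0 *: f + mu0 *: g; pose H := (la - la0) *: f + (mu - mu0) *: g.
have GHE t : G + t *: H = (la0 + t * (la - la0)) *: f + (mu0 + t * (mu - mu0)) *: g.
  by rewrite /G /H scalerDr !scalerA !scalerDl addrACA.
have Gw0 : ev idfun w0 G = 0 by rewrite ev_pencil /la0 /mu0; ring.
have GHw0 t : ev idfun w0 (G + t *: H) = t * ev idfun w0 (la *: f + mu *: g).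
  by rewrite GHE !ev_pencil /la0 /mu0; ring.
have lm00 : (la0, mu0) != (0, 0).
  apply/eqP => -[g0 /eqP]; rewrite oppr_eq0 => /eqP f0.
  exact: no_base w00 Fw0.2 f0 g0.
have real t : real_common_zeros F (G + t *: H).
  rewrite GHE; apply: real_pencil; apply/eqP => -[e1 e2].
  have : ev idfun w0 (G + t *: H) = 0 by rewrite GHE e1 e2 !scale0r addr0 /ev mmap0.
  rewrite GHw0 => /eqP; rewrite mulf_eq0 (negbTE hw0) orbF => /eqP t0.
  rewrite t0 !mul0r !addr0 in e1 e2.
  by case/eqP: lm00; congr pair.
have cev (h : mpoly 3 R) : continuous (fun w : 'rV[R]_3 => ev idfun w h).
  exact: continuous_ev.
pose T : set R := [set t | exists2 w, piece i w & ev idfun w (G + t *: H) = 0].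
have evGH t w : ev idfun w (G + t *: H) = ev idfun w G + t * ev idfun w H.
  by rewrite evD evZ.
have cT : closed T.
  pose Z : set ('rV[R]_3 * R) := [set x | ev idfun x.1 G + x.2 * ev idfun x.1 H = 0].
  rewrite (_ : T = [set t | exists2 w, piece i w & Z (w, t)]).
    apply: closed_projection; first exact: compact_piece.
    apply: closed_zeros => x; apply: cvgD; first exact: continuous_ev_fst.
    by apply: cvgM; [exact: cvg_snd | exact: continuous_ev_fst].
  by apply/seteqP; split=> t [w iw e]; exists w => //; move: e; rewrite /Z /= evGH.
have oT : open T.
  rewrite openE => t0 /= [p ip hp]; rewrite /interior.
  have [Fp cp] := ip; have p0 := unit_curve_neq0 Fp.
  have [N [x0 [sep persist]]] := zero_persists hF FD D0 (pencil_homog la0 mu0)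
    (pencil_homog (la - la0) (mu - mu0)) real p0 Fp.2 hp.
  pose K' := unit_curve F `&` [set w | c w != i].
  pose dist (w : 'rV[R]_3) := `|(w *m N) 0 2 - x0 * (w *m N) 0 1|.
  pose Z : set ('rV[R]_3 * (R * R)) :=
    [set x | ev idfun x.1 G + x.2.1 * ev idfun x.1 H = 0] `&`
    [set x | 0 <= x.2.2 * `|(x.1 *m N) 0 1| - dist x.1].
  have cZ : closed Z.
    apply: closedI.
      apply: closed_zeros => x; apply: cvgD; first exact: continuous_ev_fst.
      apply: cvgM; last exact: continuous_ev_fst.
      by apply: (@continuous_comp _ _ _ snd fst); [exact: cvg_snd | exact: cvg_fst].
    apply: closed_nonneg => x; apply: cvgB.
      apply: cvgM; last by apply: cvg_norm; exact: continuous_linear_form_fst.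
      by apply: (@continuous_comp _ _ _ snd snd); [exact: cvg_snd | exact: cvg_snd].
    apply: cvg_norm; apply: cvgB; first exact: continuous_linear_form_fst.
    by apply: cvgM; [exact: cvg_cst | exact: continuous_linear_form_fst].
  have := closed_projection (@compact_other_pieces i) cZ.
  rewrite -openC openE => /(_ (t0, 0)) /= [].
    move=> [q [Fq cq] [/= hq]]; rewrite mul0r sub0r oppr_ge0 normr_le0 subr_eq0 => /eqP qN.
    have [a qE] : exists a, q = a *: p.
      by apply: sep => //; [exact: unit_curve_neq0 | exact: Fq.2 | rewrite evGH].
    by move: cq; rewrite /= qE c_scale ?cp ?eqxx// -qE.
  move=> [A B] [/= At0 B0] AB.
  (* Near [t0], the zeros on the other pieces keep a distance from the abscissa
     [x0], measured by [e]. *)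
  have [e /= e0 eB] := (nbhs_ballP _ _).1 B0.
  have {}eB : B (e / 2).
    apply: eB; rewrite /ball /= sub0r normrN gtr0_norm ?divr_gt0// ltr_pdivrMr//.
    by rewrite ltr_pMr// ltr1n.
  have [|q0 [q1 [q0t q1t small]]] := persist (e / 2); first by rewrite divr_gt0.
  have near_q : \forall t \near t0, `|q0.[t]| < `|q1.[t]|.
    have : \forall t \near t0, 0 < `|q1.[t]| - `|q0.[t]|.
      have cq : (fun t => `|q1.[t]| - `|q0.[t]|) @ t0 --> `|q1.[t0]| - `|q0.[t0]|.
        by apply: cvgB; apply: cvg_norm; exact: continuous_horner.
      apply: (cvgr_gt _ cq); rewrite (rootP q0t) normr0 subr0 normr_gt0.
      exact: q1t.
    by apply: filterS => t; rewrite subr_gt0.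
  apply: filterS2 At0 near_q => t At qt.
  have [w [w0' Fw hw wN]] := small t qt.
  have hGH : G + t *: H \is ishomog1 k mdeg by rewrite GHE pencil_homog.
  have [Fw1 hw1] := normalize_zero hGH w0' Fw hw.
  exists (`|w|^-1 *: w) => //; split=> //.
  apply/eqP/negPn/negP => cw; apply: (AB (t, e / 2)) => //.
  exists (`|w|^-1 *: w); first by split.
  split; first by rewrite /= -evGH.
  rewrite /= /dist -!scalemxAl !mxE.
  rewrite mulrCA -mulrBr !normrM mulrCA -mulrBr mulr_ge0// subr_ge0 ltW//.
  by move: wN; rewrite !mxE.
have T1 : T 1.
  have -> // : T = [set: R].
  apply: connected_line; first by exists 0, w0 => //; rewrite GHw0 mul0r.
    by exists T; [exact: oT | rewrite setTI].
  by exists T; [exact: cT | rewrite setTI].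
have [w iw hw] := T1; exists w => //; move: hw; rewrite GHE.
by rewrite !mul1r !subrKC.
Qed.

Hypothesis hl : (k * d.+1 <= l)%N.

(** This is how counting works: one point on each of the [l] pieces and one more
    point give [l + 1] distinct points. *)
Lemma representatives_nonproportional (s : 'I_l -> 'rV[R]_3) i w' :
  (forall j, piece j (s j)) -> piece i w' -> (forall a, w' != a *: s i) ->
  pairwise_nonproportional (w' :: [seq s j | j <- enum 'I_l]).
Proof.
move=> hs iw' nw'.
have s_inj : injective s by move=> j j' e; rewrite -(hs j).2 e (hs j').2.
have s_ne a : s i != a *: w'.
  apply/eqP => e; have a0 : a != 0.
    apply/eqP => a0; have /negP := unit_curve_neq0 (hs i).1.
    by rewrite e a0 scale0r eqxx.
  by have := nw' a^-1; rewrite e scalerA mulVf// scale1r eqxx.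
split=> [|p p'].
  rewrite /= map_inj_uniq// enum_uniq andbT; apply/mapP => -[j _ e].
  have ji : j = i by rewrite -(hs j).2 -e iw'.2.
  by have := nw' 1; rewrite e ji scale1r eqxx.
have same_piece q q' a : unit_curve F q -> unit_curve F q' -> q' = a *: q ->
    c q' = c q by move=> qF q'F e; rewrite e c_scale// -e.
rewrite !inE => /orP[/eqP ->|/mapP[j _ ->]] /orP[/eqP ->|/mapP[j' _ ->]].
- by rewrite eqxx.
- move=> _ a; apply/eqP => e.
  have := same_piece _ _ _ iw'.1 (hs j').1 e; rewrite (hs j').2 iw'.2 => ji.
  by move/eqP: e; rewrite ji (negbTE (s_ne a)).
- move=> _ a; apply/eqP => e.
  have := same_piece _ _ _ (hs j).1 iw'.1 e; rewrite (hs j).2 iw'.2 => ji.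
  by move/eqP: e; rewrite -ji (negbTE (nw' a)).
move=> ne a; apply/eqP => e; move: ne.
have := same_piece _ _ _ (hs j).1 (hs j').1 e; rewrite (hs j).2 (hs j').2 => ->.
by rewrite eqxx.
Qed.

(** A second zero on the same piece would give [l + 1 > k d] zeros in all. *)
Theorem zero_of_member_unique i la mu w w' : (la, mu) != (0, 0) ->
  piece i w -> ev idfun w (la *: f + mu *: g) = 0 ->
  piece i w' -> ev idfun w' (la *: f + mu *: g) = 0 -> exists a, w' = a *: w.
Proof.
move=> lm0 iw hw iw' hw'; apply: contrapT => nw'.
have /choice[s hs] : forall j, exists y, [/\ piece j y,
    ev idfun y (la *: f + mu *: g) = 0 & j = i -> y = w].
  move=> j; have [->|ji] := eqVneq j i; first by exists w.
  have [y jy hy] := piece_meets_member j lm0.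
  by exists y; split=> // e; rewrite e eqxx in ji.
have sp j : piece j (s j) by case: (hs j).
have si : s i = w by case: (hs i) => _ _; apply.
suff : (l < k * d.+1)%N by rewrite ltnNge hl.
have := bezout hF FD D0 (pencil_homog la mu) (real_pencil lm0)
  (ps := w' :: [seq s j | j <- enum 'I_l]).
rewrite /= size_map size_enum_ord; apply; split.
  apply: (representatives_nonproportional sp iw') => a; rewrite si.
  by apply/eqP => e; apply: nw'; exists a.
move=> p /[!inE] /orP[/eqP ->|/mapP[j _ ->]].
  by split=> //; [exact: unit_curve_neq0 iw'.1 | exact: iw'.1.2].
by have [[Fs _] hsj _] := hs j; split=> //; [exact: unit_curve_neq0 | exact: Fs.2].
Qed.

(** Let [t] run over the real line and turn the member [a f + b g] with
    [(a, b) = (1 - t, t (2 - t))], which goes half around from [f] at [t = 0] to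
    [- f] at [t = 2].  At its unique zero on the piece the product of
    [a g - b f] and [u ^+ k] is non-zero, with a sign
    independent of the representative.  The two signs cut the line of parameters
    into two closed sets, while the signs at [0] and [2] are opposite. *)
Theorem piece_meets_line i (U : 'cV[R]_3) :
  exists2 w, piece i w & (w *m U) 0 0 = 0.
Proof.
apply: contrapT => nomeet.
pose u (w : 'rV[R]_3) := (w *m U) 0 0.
have u0 w : piece i w -> u w != 0.
  by move=> iw; apply/eqP => uw; apply: nomeet; exists w.
pose a_ (t : R) := 1 - t; pose b_ (t : R) := t * (2 - t).
have ab0 t : 0 < a_ t ^+ 2 + b_ t ^+ 2
  by rewrite /a_ /b_; have := sqr_ge0 ((1 - t) ^+ 2 - 2^-1); nra.
pose X (x : 'rV[R]_3 * R) :=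
  (a_ x.2 * ev idfun x.1 g - b_ x.2 * ev idfun x.1 f) * u x.1 ^+ k.
pose P (sg : R) := [set t | exists2 w, piece i w &
  ([set x | a_ x.2 * ev idfun x.1 f + b_ x.2 * ev idfun x.1 g = 0] `&`
   [set x | 0 <= sg * X x]) (w, t)].
have ca : continuous (fun x : 'rV[R]_3 * R => a_ x.2).
  by move=> x; apply: cvgB; [exact: cvg_cst | exact: cvg_snd].
have cb : continuous (fun x : 'rV[R]_3 * R => b_ x.2).
  move=> x; apply: cvgM; first exact: cvg_snd.
  by apply: cvgB; [exact: cvg_cst | exact: cvg_snd].
have clP sg : closed (P sg).
  apply: closed_projection; first exact: compact_piece.
  apply: closedI.
    by apply: closed_zeros => x; apply: cvgD; apply: cvgM;
      [exact: ca | exact: continuous_ev_fst | exact: cb | exact: continuous_ev_fst].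
  apply: closed_nonneg => x; apply: cvgM; first exact: cvg_cst.
  apply: cvgM.
    by apply: cvgB; apply: cvgM;
      [exact: ca | exact: continuous_ev_fst | exact: cb | exact: continuous_ev_fst].
  apply: (@continuous_comp _ _ _ (fun x : 'rV[R]_3 * R => u x.1) (fun y => y ^+ k)).
    exact: continuous_linear_form_fst.
  exact: exprn_continuous.
have member t : (a_ t, b_ t) != (0, 0).
  by apply/eqP => -[a0 b0]; have := ab0 t; rewrite a0 b0 expr0n addr0 ltxx.
have cover t : P 1 t \/ P (-1) t.
  have [w iw hw] := piece_meets_member i (member t).
  rewrite ev_pencil in hw.
  have [X0|X0] := leP 0 (X (w, t)).
    by left; exists w => //; split=> //=; rewrite mul1r.
  by right; exists w => //; split=> //=; rewrite mulN1r oppr_ge0 ltW.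
have disj t : P 1 t -> P (-1) t -> False.
  move=> [w iw [/= hw Xw]] [w' iw' [/= hw' Xw']].
  have [r wE] := zero_of_member_unique (member t) iw
    (etrans (ev_pencil _ _ _) hw) iw' (etrans (ev_pencil _ _ _) hw').
  have r0 : r != 0.
    apply/eqP => r0; have /negP := unit_curve_neq0 iw'.1.
    by rewrite wE r0 scale0r eqxx.
  have XE : X (w', t) = (r ^+ 2) ^+ k * X (w, t).
    rewrite /X /= wE /u -scalemxAl [(_ *: (w *m U)) 0 0]mxE.
    by rewrite (ev_scale _ _ _ hf) (ev_scale _ _ _ hg) -exprM mul2n -addnn exprD exprMn; ring.
  have rk : 0 < (r ^+ 2) ^+ k by rewrite exprn_gt0// exprn_even_gt0.
  have X0 : X (w, t) = 0.
    apply/le_anti; move: Xw Xw'; rewrite mul1r XE mulN1r oppr_ge0 pmulr_rle0//.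
    by move=> -> ->.
  move/eqP: X0; rewrite /X /= mulf_eq0 expf_eq0 (negbTE (u0 _ iw)) andbF orbF.
  move=> /eqP dw; have := ab0 t; set A := a_ t in hw dw *; set B := b_ t in hw dw *.
  move=> AB; apply: (no_base (unit_curve_neq0 iw.1) iw.1.2).
    apply: (mulfI (lt0r_neq0 AB)); rewrite mulr0.
    transitivity (A * (A * ev idfun w f + B * ev idfun w g) -
                  B * (A * ev idfun w g - B * ev idfun w f)); first by ring.
    by rewrite hw dw !mulr0 subr0.
  apply: (mulfI (lt0r_neq0 AB)); rewrite mulr0.
  transitivity (B * (A * ev idfun w f + B * ev idfun w g) +
                A * (A * ev idfun w g - B * ev idfun w f)); first by ring.
  by rewrite hw dw !mulr0 addr0.
have [w0 iw0 fw0] : exists2 w, piece i w & ev idfun w f = 0.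
  have [|w iw] := @piece_meets_member i 1 0; first by rewrite xpair_eqE oner_eq0.
  by rewrite ev_pencil mul1r mul0r addr0; exists w.
have X2 : X (w0, 2) = - X (w0, 0).
  by rewrite /X /a_ /b_ /= fw0; ring.
have c0 t : t * (2 - t) = 0 -> a_ t * ev idfun w0 f + b_ t * ev idfun w0 g = 0.
  by move=> tt; rewrite fw0 /b_ tt mulr0 mul0r addr0.
have in0 sg : 0 <= sg * X (w0, 0) -> P sg 0.
  by move=> h; exists w0 => //; split=> //=; apply: c0; rewrite mul0r.
have in2 sg : 0 <= - sg * X (w0, 0) -> P sg 2.
  move=> h; exists w0 => //; split=> /=; first by apply: c0; rewrite subrr mulr0.
  by rewrite X2 mulrN -mulNr.
have PT : P 1 !=set0 -> P 1 = [set: R].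
  move=> ne; apply: connected_line => //.
    exists (~` P (-1)); first exact/closed_openC/clP.
    rewrite setTI; apply/seteqP; split=> t; first by move=> h h'; exact: disj h h'.
    by case: (cover t).
  by exists (P 1); [exact: clP | rewrite setTI].
have [X0|X0] := leP 0 (X (w0, 0)).
  have P0 : P 1 0 by apply: in0; rewrite mul1r.
  apply: (disj 2); last by apply: in2; rewrite opprK mul1r.
  by rewrite PT//; exists 0.
have P2 : P 1 2 by apply: in2; rewrite mulN1r oppr_ge0 ltW.
apply: (disj 0); last by apply: in0; rewrite mulN1r oppr_ge0 ltW.
by rewrite PT//; exists 2.
Qed.

(** The line through a zero [w1] of [f] and a zero [w2] of [g] on one piece meets
    every piece, hence meets the curve in more than [d.+1] points. *)
Theorem pencil_contradiction : smooth F -> (0 < d)%N -> (0 < k)%N -> False.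
Proof.
move=> sm d0 k0.
have l0 : (0 < l)%N by rewrite (leq_trans _ hl)// muln_gt0 k0.
pose i0 : 'I_l := Ordinal l0.
have [|w1 iw1] := @piece_meets_member i0 1 0; first by rewrite xpair_eqE oner_eq0.
have [|w2 iw2] := @piece_meets_member i0 0 1.
  by rewrite xpair_eqE oner_eq0 andbF.
rewrite !ev_pencil !mul0r !mul1r add0r addr0 => gw2 fw1.
have nprop a : w2 != a *: w1.
  apply/eqP => e; apply: (no_base (unit_curve_neq0 iw2.1) iw2.1.2) => //.
  by rewrite e (ev_scale _ _ _ hf) fw1 mulr0.
(* [W] has two rows, so its rows lie in the span of rows 0 and 1 of its
   row basis: the line through [w1] and [w2] is where coordinate 2 vanishes. *)
pose W := col_mx w1 w2; pose Q := row_ebase W; pose N : 'M[R]_3 := invmx Q.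
have QN : Q *m N = 1%:M by rewrite mulmxV// row_ebase_unit.
have WN i : (W *m N) i 2 = 0.
  rewrite -[W]mulmx_ebase -!mulmxA mulmxV ?row_ebase_unit// mulmx1 mxE big1// => j _.
  by rewrite mxE; case: eqP => [e|]; rewrite ?mulr0//; have := ltn_ord j; rewrite e.
have w1N : (w1 *m N) 0 2 = 0.
  by have := WN (lshift 1 0); rewrite mul_col_mx col_mxEu.
have w2N : (w2 *m N) 0 2 = 0.
  by have := WN (rshift 1 0); rewrite mul_col_mx col_mxEd.
have /choice[s hs] : forall j, exists y, [/\ piece j y, (y *m N) 0 2 = 0 &
    j = i0 -> y = w1].
  move=> j; have [->|ji] := eqVneq j i0; first by exists w1.
  have [y jy] := piece_meets_line j (col 2 N); rewrite colE mulmxA -colE mxE => yN.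
  by exists y; split=> // e; rewrite e eqxx in ji.
have sp j : piece j (s j) by case: (hs j).
have si : s i0 = w1 by case: (hs i0) => _ _; apply.
have [|||Q' [N' [QN' al0]]] := line_in_curve hF QN
  (ps := w2 :: [seq s j | j <- enum 'I_l]).
- by apply: (representatives_nonproportional sp iw2) => a; rewrite si.
- move=> p /[!inE] /orP[/eqP ->|/mapP[j _ ->]].
    by split=> //; [exact: unit_curve_neq0 iw2.1 | exact: iw2.1.2].
  by have [[Fs _] hsj _] := hs j; split=> //; [exact: unit_curve_neq0 | exact: Fs.2].
- rewrite /= size_map size_enum_ord ltnS (leq_trans _ hl)//.
  by rewrite leq_pmull.
by have := smooth_no_line hF d0 sm QN'; rewrite al0 eqxx.
Qed.

End Pieces.

(** * From components of the real locus to pieces on a sphere *)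

Section RealPoints.
Variable R : realType.
Implicit Types (w : 'rV[R]_3) (Z : set (CP2 R)).

Lemma evalC_ev (F : mpoly 3 R) v : evalC F v = ev (real_complex R) v F.
Proof. by rewrite evalCE evE. Qed.

(** The topology on [R[i]] comes from a modulus with values in [R[i]] itself, so
    a radius is a complex number whose imaginary part is zero. *)
Lemma open_preimage_complexify (U : set 'rV[R[i]]_3) :
  open U -> open [set w : 'rV[R]_3 | U (complexify w)].
Proof.
rewrite !openE => oU w /= Uw; have /nbhs_ballP[e /= e0 eU] := oU _ Uw.
move: (e0); rewrite ltcE /= => /andP[/eqP e_real Re0].
apply/nbhs_ballP; exists (complex.Re e) => //= w' [_ ww']; apply: eU; split=> // i j.
have := ww' i j; rewrite /ball /= !mxE => ww'ij.
by rewrite -rmorphB normc_def /= expr0n addr0 sqrtr_sqr ltcE /= e_real eqxx.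
Qed.

Lemma closed_lift Z : closed Z ->
  exists2 Z' : set 'rV[R]_3, closed Z' &
    forall (v : nzvec R) w, val v = complexify w -> Z (Defs.proj v) <-> Z' w.
Proof.
move=> /closed_openC oZ.
have [U oU UE] : open (@Defs.proj R @^-1` (~` Z)) by exact: oZ.
exists (~` [set w | U (complexify w)]); first exact/open_closedC/open_preimage_complexify.
have UZ (v : nzvec R) : U (val v) <-> ~ Z (Defs.proj v).
  by rewrite -[~ Z _]/((@Defs.proj R @^-1` (~` Z)) v) -UE.
move=> v w vw; split=> [Zv /=|/= nU]; first by rewrite -vw => /UZ.
by apply: contrapT => /UZ; rewrite vw.
Qed.

Lemma eq_proj (v v' : nzvec R) :
  (exists2 a : R[i], a != 0 & val v' = a *: val v) -> Defs.proj v = Defs.proj v'.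
Proof. by move=> h; apply/eqmodP/asboolP. Qed.

(** If [v = a v^*] then [v + v^*] is real and proportional to [v], unless
    [a = -1], in which case [v] is purely imaginary. *)
Lemma fixed_proj (v : nzvec R) : conjCP2 (Defs.proj v) = Defs.proj v ->
  exists (c : R[i]) w, val v = c *: complexify w.
Proof.
rewrite conjCP2_proj => /eqmodP/asboolP[a a0 /= vE].
pose re := map_mx (@complex.Re R) (val v); pose im := map_mx (@complex.Im R) (val v).
have {}vE : val v = a *: map_mx conjc (val v) by exact: vE.
have [a1|a1] := eqVneq (a + 1) 0.
  exists 'i, im; apply/rowP => j; move/rowP: (vE) => /(_ j).
  rewrite !mxE (_ : a = -1); last by apply/eqP; rewrite -addr_eq0 a1.
  case: (val v 0 j) => x y /eqP; rewrite mulN1r eq_complex /= opprK => /andP[/eqP xx _].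
  by apply/eqP; rewrite eq_complex /=; apply/andP; split; apply/eqP; lra.
exists (a * (2 / (a + 1))), re.
rewrite -scalerA {1}vE; congr (_ *: _); apply: (scalerI a1).
rewrite scalerA mulrCA mulfV// mulr1.
rewrite scalerDl scale1r -{1}vE; apply/rowP => j; rewrite !mxE.
case: (val v 0 j) => x y; apply/eqP; rewrite eq_complex /=.
by apply/andP; split; apply/eqP; lra.
Qed.

Lemma complexify_nzvec w : w != 0 -> @nzvec R (complexify w).
Proof. by move=> w0; rewrite /nzvec /= map_mx_eq0. Qed.

Definition real_nzvec w (w0 : w != 0) : nzvec R := SigSub (mem_set (complexify_nzvec w0)).

Lemma proj_scale w w' (w0 : w != 0) (w'0 : w' != 0) a : w' = a *: w ->
  Defs.proj (real_nzvec w0) = Defs.proj (real_nzvec w'0).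
Proof.
move=> e; apply: eq_proj; exists (a%:C); last by rewrite /= e /complexify map_mxZ.
by rewrite fmorph_eq0; apply: contraNneq w'0 => a0; rewrite e a0 scale0r.
Qed.

(** [K] and [closure K] enclose [closure K `&` A], which is therefore connected.
    With this the components need only be closed relative to the real locus. *)
Lemma closure_component (T : topologicalType) (A : set T) x :
  closure (connected_component A x) `&` A `<=` connected_component A x.
Proof.
set K := connected_component A x; move=> y [cKy Ay].
have Kx : K x.
  apply: contrapT => nKx; have Ax : ~ A x.
    by move=> Ax; apply: nKx; exact: connected_component_refl.
  by move: cKy; rewrite /K connected_component_out// closure0.
suff cKA : connected (closure K `&` A).
  apply: (@connected_component_max T A (closure K `&` A) x _ _ cKA y) => //.
  by split; [exact: subset_closure | exact: connected_component_sub Kx].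
apply/connectedP => E [E0 EU sepE].
have KE : K `<=` E false `|` E true.
  by rewrite -EU => z Kz; split; [exact: subset_closure | exact: connected_component_sub Kz].
have [] := connected_subset sepE KE (@component_connected _ A x) => KEb.
  have [z Etz] := E0 true; have : (closure K `&` A) z by rewrite EU; right.
  case=> /(closure_subset KEb) cz _; case: sepE => /seteqP[h _] _.
  exact: (h z (conj cz Etz)).
have [z Efz] := E0 false; have : (closure K `&` A) z by rewrite EU; left.
case=> /(closure_subset KEb) cz _; case: sepE => _ /seteqP[h _].
exact: (h z (conj Efz cz)).
Qed.

Lemma real_point_rep (C : set (CP2 R)) p : real_points C p ->
  exists (w : 'rV[R]_3) (w0 : w != 0), `|w| = 1 /\ p = Defs.proj (real_nzvec w0).
Proof.
move=> [_]; have [v <-] : exists v, Defs.proj v = p.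
  by exists (repr p); rewrite /Defs.proj reprK.
move=> /fixed_proj[c [w vE]].
have w0 : w != 0.
  have /negP := set_valP v; apply: contra_notN => /eqP w0; apply/eqP.
  by rewrite -[LHS]/(val v) vE w0 /complexify map_mx0 scaler0.
have c0 : c != 0.
  have /negP := set_valP v; apply: contra_notN => /eqP c0; apply/eqP.
  by rewrite -[LHS]/(val v) vE c0 scale0r.
have w1 : `|w|^-1 *: w != 0 by rewrite scaler_eq0 invr_eq0 normr_eq0 (negbTE w0).
exists (`|w|^-1 *: w), w1; split.
  by rewrite normrZ normfV normr_id mulVf// normr_eq0.
apply: eq_proj; exists (`|w|%:C^-1 / c).
  by rewrite mulf_neq0 ?invr_eq0// fmorph_eq0 normr_eq0.
by rewrite /= vE scalerA divfK// /complexify map_mxZ fmorphV.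
Qed.

(** The components, being finitely many, can be numbered; [c] sends a vector to
    the number of the component of the point that it represents. *)
Lemma component_pieces (P : mpoly 3 R) d l : P \is ishomog1 d mdeg ->
  nb_components (real_points (V P)) l.+1 ->
  exists c : 'rV[R]_3 -> 'I_l.+1,
    [/\ forall i, closed (unit_curve P `&` [set w | c w = i]),
        forall w a, unit_curve P w -> unit_curve P (a *: w) -> c (a *: w) = c w &
        forall i, (unit_curve P `&` [set w | c w = i]) !=set0].
Proof.
move=> hP; set A := real_points (V P) => /card_set_bijP[f [f_img f_inj f_surj]].
have A_nz w (w0 : w != 0) : ev idfun w P = 0 -> A (Defs.proj (real_nzvec w0)).
  move=> Pw; split.
    by exists (real_nzvec w0) => //=; rewrite evalC_ev ev_complexify Pw.
  rewrite conjCP2_proj; apply/esym/eq_proj; exists 1; first exact: oner_neq0.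
  by rewrite scale1r /=; apply/rowP => j; rewrite !mxE conjc_real.
pose comp w := [set q | exists w0 : w != 0,
  connected_component A (Defs.proj (real_nzvec w0)) q].
have compE w (w0 : w != 0) : comp w = connected_component A (Defs.proj (real_nzvec w0)).
  apply/seteqP; split=> [q [w0' h]|q h]; last by exists w0.
  by rewrite (proj_scale w0 w0' (a := 1)) ?scale1r.
pose c w : 'I_l.+1 := inord (f (comp w)).
have unit_nz w : unit_curve P w -> w != 0.
  by move=> [w1 _]; apply/eqP => w0; move: w1; rewrite w0 normr0 => /esym/eqP;
     rewrite oner_eq0.
have comp_in w : unit_curve P w -> [set connected_component A p | p in A] (comp w).
  move=> Pw; rewrite (compE _ (unit_nz _ Pw)).
  by exists (Defs.proj (real_nzvec (unit_nz _ Pw))) => //; exact: A_nz Pw.2.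
have cE w : unit_curve P w -> (c w : nat) = f (comp w).
  by move=> Pw; rewrite /c inordK//; exact: (f_img _ (comp_in _ Pw)).
have rep (i : 'I_l.+1) : exists2 p, A p & f (connected_component A p) = i :> nat.
  by have [|_ [p Ap <-] fp] := f_surj (i : nat); [exact: ltn_ord | exists p].
have pieceE (i : 'I_l.+1) p : A p -> f (connected_component A p) = i :> nat ->
    forall w (w0 : w != 0), unit_curve P w ->
      c w = i <-> connected_component A p (Defs.proj (real_nzvec w0)).
  move=> Ap fp w w0 Pw; have Aw := A_nz w w0 Pw.2; split=> [cw|pw].
    have : f (comp w) = f (connected_component A p) by rewrite fp -cE// cw.
    move=> /f_inj; rewrite !inE => /(_ (comp_in _ Pw)) <-; last by exists p.
    by rewrite (compE _ w0); exact: connected_component_refl.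
  apply: val_inj; rewrite [LHS]cE//= -fp (compE _ w0).
  by rewrite (same_connected_component pw).
exists c; split=> [i|w a Pw Paw|i].
- have [p Ap fp] := rep i.
  have [Z cZ ZE] := closed_lift (@closed_closure _ (connected_component A p)).
  rewrite (_ : _ `&` _ = unit_curve P `&` Z).
    apply: closedI => //; apply: closedI; last first.
      exact: closed_zeros (@continuous_ev _ _ P).
    apply: (@preimage_closed _ _ (fun w : 'rV[R]_3 => `|w|) [set y | y = 1] _
      (@closed_eq R 1)) => w _; exact: norm_continuous.
  apply/seteqP; split=> w [Pw].
    move=> /= /(pieceE i p Ap fp w (unit_nz _ Pw) Pw) Kw; split=> //.
    by apply/(ZE (real_nzvec (unit_nz _ Pw))) => //; exact: subset_closure.
  move=> Zw; split=> //=; apply/(pieceE i p Ap fp w (unit_nz _ Pw) Pw).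
  apply: closure_component; split; last exact: A_nz Pw.2.
  by apply/(ZE (real_nzvec (unit_nz _ Pw)) w).
- apply: val_inj; rewrite [LHS]cE// [RHS]cE//.
  rewrite (compE _ (unit_nz _ Pw)) (compE _ (unit_nz _ Paw)).
  by rewrite (proj_scale (unit_nz _ Pw) (unit_nz _ Paw) (a := a)).
have [p Ap fp] := rep i.
have [w [w0 [w1 pE]]] := real_point_rep Ap.
have Pw : unit_curve P w.
  split=> //; have : V P p by case: Ap.
  rewrite pE (V_proj (k := d)) //= evalC_ev ev_complexify => /eqP.
  by rewrite fmorph_eq0 => /eqP.
exists w; split=> //=; apply/(pieceE i p Ap fp w w0 Pw).
by rewrite -pE; exact: connected_component_refl.
Qed.

End RealPoints.

(** * The theorem *)

Lemma type_I_nonreal_point (R : realType) (C : set (CP2 R)) :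
  type_I C -> exists2 v : nzvec R, C (Defs.proj v) & ~ real_points C (Defs.proj v).
Proof.
move=> tI; apply: contrapT => noV; apply: tI.
rewrite (_ : C `\` real_points C = set0); first exact: connected0.
apply/seteqP; split=> // p [Cp nAp]; apply: noV; exists (repr p);
  by rewrite /Defs.proj reprK.
Qed.

(** For [k < 0] both forms are zero and all of [C] is in the base locus.  For
    [k = 0] they are constants [a] and [b], and the member [b f - a g] contains
    [C], although [C] has a non-real point. *)
Lemma pencil_degree_gt0 (R : realType) (C : set (CP2 R)) (k : int) :
  type_I C -> totally_real_pencil C k -> exists n, k = n.+1%:Z.
Proof.
move=> /type_I_nonreal_point[v Cv nAv] [f [g [hf hg base real]]].
have V0 (h : mpoly 3 R) : ev (real_complex R) (val v) h = 0 -> V h (Defs.proj v).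
  by move=> h0; exists v => //=; rewrite evalC_ev.
have nbase : ~ (V f (Defs.proj v) /\ V g (Defs.proj v)).
  by move=> [fv gv]; have : set0 (Defs.proj v) by rewrite -base.
case: k hf hg => [[|n]|n] hf hg; last 2 first.
- by exists n.
- by case: nbase; split; apply: V0; rewrite ?hf ?hg /ev mmap0.
have const (h : mpoly 3 R) : h \is ishomog1 0 mdeg ->
    ev (real_complex R) (val v) h = (ev idfun (0 : 'rV[R]_3) h)%:C.
  move=> hh; rewrite -ev_complexify -[LHS]mul1r -(expr0 (0 : R[i])) -(ev_scale _ _ _ hh).
  by rewrite scale0r /complexify map_mx0.
case: nAv; pose a := ev idfun (0 : 'rV[R]_3) f; pose b := ev idfun (0 : 'rV[R]_3) g.
apply: (real b (- a)); last first.
  split=> //; apply: V0; rewrite evD !evZ !const// -/a -/b.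
  by rewrite rmorphN /= mulNr mulrC subrr.
apply/eqP => -[b0 /eqP]; rewrite oppr_eq0 => /eqP a0.
by apply: nbase; split; apply: V0; rewrite const// -/a -/b ?a0 ?b0 rmorph0.
Qed.

(** Translation of [pencil_contradiction] to the projective plane. *)
Theorem no_totally_real_pencil (R : realType) (d l : nat) (C : set (CP2 R)) :
  (1 < d)%N -> nonsingular_real_curve d C -> type_I C ->
  nb_components (real_points C) l ->
  forall k : int, k * d%:Z <= l%:Z -> ~ totally_real_pencil C k.
Proof.
case: d => // d d0 [P [hP nsP ->]] tI nbl k kl pencil.
have [n kE] := pencil_degree_gt0 tI pencil; move: kl pencil; rewrite {k}kE.
rewrite -PoszM lez_nat => kl [f [g [hf hg base real]]].
case: l nbl kl => [|l] nbl kl; first by rewrite mulnS in kl.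
have [c [cl sc ne]] := component_pieces hP nbl.
have smP : smooth P.
  move=> v v0; have v0' : @nzvec R v by [].
  rewrite -evalC_ev => /(nsP (SigSub (mem_set v0')))[j Pj].
  by exists j; rewrite -evalC_ev.
have VE (m : nat) (h : mpoly 3 R) (v : 'rV[R[i]]_3) (v0 : @nzvec R v) :
    h \is ishomog1 m mdeg ->
    V h (Defs.proj (SigSub (mem_set v0))) <-> ev (real_complex R) v h = 0.
  by move=> hh; rewrite (V_proj (k := m)) // evalC_ev.
have real' la mu : (la, mu) != (0, 0) -> real_common_zeros P (la *: f + mu *: g).
  move=> lm v v0 Pv hv; have v0' : @nzvec R v by [].
  have [_ fixv] : real_points (V P) (Defs.proj (SigSub (mem_set v0'))).
    apply: (real _ _ lm); split; last exact/(VE _ _ _ _ hP).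
    by apply/(VE n.+1) => //; rewrite rpredD// rpredZ.
  exact: fixed_proj fixv.
have base' (w : 'rV[R]_3) : w != 0 -> ev idfun w P = 0 ->
    ev idfun w f = 0 -> ev idfun w g = 0 -> False.
  move=> w0 Pw fw gw; have : set0 (Defs.proj (real_nzvec w0)); last by [].
  rewrite -base; split; [split|].
  - by apply/(VE _ _ _ _ hf); rewrite ev_complexify fw.
  - by apply/(VE _ _ _ _ hg); rewrite ev_complexify gw.
  - by apply/(VE _ _ _ _ hP); rewrite ev_complexify Pw.
have [w [Pw _]] := ne ord0.
have [D D0 PD] := smooth_nonzero_value hP smP (unit_curve_neq0 Pw) Pw.2.
exact: (pencil_contradiction hP hf hg D0 PD base' real' cl sc ne kl smP).
Qed.

Local Close Scope complex_scope.

Theorem corollary1p6 (R : realType) (d l : nat) (C : set (CP2 R)) :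
  nonsingular_real_curve d C ->
  type_I C ->
  nb_components (real_points C) l ->
  (exists s eps : int,
     [/\ 2 <= s, d%:Z = 2 * s + 1,
         (eps = 0 \/ eps = 1) /\ (l%:Z = eps %[mod 2])%Z,
         1 - eps%:~R + (s%:~R ^+ 2 - 5 * s%:~R + 4) / 2
           < (Num.floor (l%:R / 2 : rat))%:~R :> rat
       & (Num.floor (l%:R / 2 : rat))%:~R
           < (s%:~R ^+ 2 + s%:~R - 2) / 2 :> rat])
  \/
  (exists s eps : int,
     [/\ 3 <= s, d%:Z = 2 * s,
         (eps = 0 \/ eps = 1) /\ (l%:Z - 1 = eps %[mod 2])%Z,
         Num.max 0 (1 - eps%:~R + (s%:~R ^+ 2 - 7 * s%:~R + 10) / 2)
           < (Num.floor ((l%:R - 1) / 2 : rat))%:~R :> rat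
       & (Num.floor ((l%:R - 1) / 2 : rat))%:~R
           < (s%:~R ^+ 2 - s%:~R - 2) / 2 :> rat]) ->
  forall k : int, k * d%:Z <= l%:Z -> ~ totally_real_pencil C k.
Proof.
move=> nsC tI nbl hds; apply: no_totally_real_pencil nsC tI nbl.
case: hds => -[s [eps [s_ge dE _ _ _]]]; lia.
Qed.
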